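(* Let $(\mathfrak g,r)$ be a finite dimensional quasitriangular Lie bialgebra over a field $\mathbf k$ of characteristic $0$. Let $\mathfrak g^*$ denote the formal neighborhood of the origin in the vector space $\mathfrak g^*$, equipped with its linear (Lie-Poisson, or Kostant-Kirillov-Souriau) Poisson structure defined by the Lie bracket of $\mathfrak g$, and let $G^*$ be the formal Poisson-Lie group with Lie bialgebra $\mathfrak g^*$. Then the formal Poisson manifolds $\mathfrak g^*$ and $G^*$ are isomorphic.
   Context: A finite dimensional quasitriangular Lie bialgebra $(\mathfrak g,r)$ is a finite dimensional Lie algebra $\mathfrak g$ with $r\in\mathfrak g^{\otimes 2}$ such that $t:=r+r^{2,1}$ is $\mathfrak g$-invariant and $[r^{1,2},r^{1,3}]+[r^{1,2},r^{2,3}]+[r^{1,3},r^{2,3}]=0$. The Lie cobracket is $\delta(x)=[x\otimes 1+1\otimes x,r]$. The dual $\mathfrak g^*$ is a Lie bialgebra whose Lie bracket is dual to $\delta$ and whose cobracket is dual to the Lie bracket of $\mathfrak g$. The function algebra of the formal manifold $\mathfrak g^*$ is $\mathcal O_{\mathfrak g^*}=\widehat S(\mathfrak g)=\widehat\oplus_{k\ge 0}S^k(\mathfrak g)$ (degree completion), with the Poisson bracket extending the Lie bracket of $\mathfrak g$, i.e. $\{f,h\}(\lambda)=\langle\lambda,[df(\lambda),dh(\lambda)]\rangle$. The function algebra of the formal group $G^*$ is $\mathcal O_{G^*}=U(\mathfrak g^* )^*$, with the Poisson-Lie bracket whose linearization at the origin is the Lie bracket of $\mathfrak g$. An isomorphism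 of formal Poisson manifolds is an isomorphism of formal manifolds whose associated (continuous) isomorphism of function algebras is an isomorphism of Poisson algebras. *)

(* Defs.v *)
From HB Require Import structures.
From mathcomp Require Import all_boot all_order all_algebra.
From mathcomp Require Import boolp functions.
From mathcomp Require Import mpoly ring.

Set Implicit Arguments.
Unset Strict Implicit.
Unset Printing Implicit Defensive.

Import GRing.Theory.
Local Open Scope ring_scope.

Record is_lie_bracket (k : fieldType) (L : lmodType k) (b : L -> L -> L)
    : Prop := IsLieBracket {
  lie_linearl : forall y, linear (b^~ y);
  lie_linearr : forall x, linear (b x);
  lie_alternating : forall x, b x x = 0;
  lie_jacobi : forall x y z, b x (b y z) + b y (b z x) + b z (b x y) = 0
}.

Record is_poisson_bracket (k : fieldType) (A : comAlgType k) (b : A -> A -> A)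
    : Prop := IsPoissonBracket {
  poisson_lie : is_lie_bracket b;
  poisson_leibniz : forall f g h, b f (g * h) = b f g * h + g * b f h
}.

(* Elements of g (x) g are represented by their matrix of coordinates in the
   basis (e_i (x) e_j) attached to the basis e = vbasis {:g} of g, and elements
   of g (x) g (x) g by their coordinates in the basis (e_i (x) e_j (x) e_l). *)
Section Bialgebra.
Variables (k : fieldType) (g : vectType k) (b : g -> g -> g).
Local Notation n := (\dim {:g}).
Local Notation e i := (vbasis {:g})`_i.
Implicit Types (x y z : g) (r t : 'M[k]_n).

Definition crd (i : 'I_n) x : k := coord (vbasis {:g}) i x.

Definition tens2 x y : 'M[k]_n := \matrix_(i, j) (crd i x * crd j y).

Definition tens3 x y z : {ffun 'I_n * 'I_n * 'I_n -> k^o} :=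
  [ffun p => crd p.1.1 x * crd p.1.2 y * crd p.2 z].

(* [x (x) 1 + 1 (x) x, t] *)
Definition ad2 x t : 'M[k]_n :=
  \sum_i \sum_j t i j *: (tens2 (b x (e i)) (e j) + tens2 (e i) (b x (e j))).

(* [r12, r13] + [r12, r23] + [r13, r23] *)
Definition cybe r : {ffun 'I_n * 'I_n * 'I_n -> k^o} :=
  \sum_i \sum_j \sum_l \sum_m (r i j * r l m) *:
    (tens3 (b (e i) (e l)) (e j) (e m)
     + tens3 (e i) (b (e j) (e l)) (e m)
     + tens3 (e i) (e l) (b (e j) (e m))).

Record is_quasitriangular r : Prop := IsQuasitriangular {
  qt_lie : is_lie_bracket b;
  qt_invariant : forall x, ad2 x (r + r^T) = 0;
  qt_cybe : cybe r = 0
}.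

Definition cobracket r x : 'M[k]_n := ad2 x r.

Definition dual := 'Hom(g, k^o).

(* <[xi, eta], x> = <xi (x) eta, cobracket x>.  The function given to linfun is
   linear as soon as b is bilinear, so that linfun returns that function. *)
Definition dual_bracket r (xi eta : dual) : dual :=
  linfun (fun x : g =>
    \sum_i \sum_j cobracket r x i j * (xi (e i) * eta (e j)) : k^o).

End Bialgebra.

(* The completed symmetric algebra: a formal series is the sequence of its
   homogeneous components. *)
Section CompletedSym.
Variables (k : fieldType) (n : nat).
Implicit Types f g h : nat -> {mpoly k[n]}.

Definition homog_seq : {pred nat -> {mpoly k[n]}} :=
  fun f => `[< forall d, f d \is d.-homog >].

Lemma homog_seqP f : reflect (forall d, f d \is d.-homog) (f \in homog_seq).
Proof. exact: asboolP. Qed.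

Fact homog_seq_submod : submod_closed homog_seq.
Proof.
split; first by apply/homog_seqP => d; rewrite dhomog0.
move=> c f g /homog_seqP fh /homog_seqP gh; apply/homog_seqP => d.
by rewrite dhomogD ?dhomogZ.
Qed.

HB.instance Definition _ :=
  GRing.isSubmodClosed.Build k (nat -> {mpoly k[n]}) homog_seq homog_seq_submod.

Record symhat := SymHat {
  symhat_val :> nat -> {mpoly k[n]};
  symhatP : symhat_val \in homog_seq
}.

HB.instance Definition _ := [isSub for symhat_val].
HB.instance Definition _ := [Choice of symhat by <:].
HB.instance Definition _ := [SubChoice_isSubLmodule of symhat by <:].

Lemma symhat_homog (f : symhat) d : f d \is d.-homog.
Proof. exact: (elimT (homog_seqP _) (symhatP f)). Qed.

Lemma symhat_eq (f g : symhat) : (forall d, f d = g d) -> f = g.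
Proof. by move=> fg; apply/val_inj/funext. Qed.

Definition cauchy f g : nat -> {mpoly k[n]} :=
  fun d => \sum_(i < d.+1) f i * g (d - i)%N.

Definition homog_one : nat -> {mpoly k[n]} := fun d => (d == 0%N)%:R.

Fact cauchy_homog (f g : symhat) : cauchy f g \in homog_seq.
Proof.
apply/homog_seqP => d; apply: rpred_sum => -[i /= id] _.
have := dhomogM (symhat_homog f i) (symhat_homog g (d - i)%N).
by rewrite subnKC -1?ltnS.
Qed.

Fact homog_one_subproof : homog_one \in homog_seq.
Proof.
by apply/homog_seqP => -[|d]; rewrite /homog_one ?dhomog1 ?dhomog0.
Qed.

Definition symhat_mul (f g : symhat) : symhat := SymHat (cauchy_homog f g).
Definition symhat_one : symhat := SymHat homog_one_subproof.

Let trunc N f : {poly {mpoly k[n]}} := \poly_(i < N) f i.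

Let cauchy_trunc N f g d : (d < N)%N -> cauchy f g d = (trunc N f * trunc N g)`_d.
Proof.
move=> dN; rewrite coefM; apply: eq_bigr => -[i /= id] _; rewrite !coef_poly.
have iN : (i < N)%N by apply: leq_trans id dN.
have diN : (d - i < N)%N by apply: leq_ltn_trans (leq_subr _ _) dN.
by rewrite iN diN.
Qed.

Fact symhat_mulC : commutative symhat_mul.
Proof.
by move=> f g; apply: symhat_eq => d /=; rewrite !(@cauchy_trunc d.+1) // mulrC.
Qed.

Fact symhat_mulA : associative symhat_mul.
Proof.
move=> f g h; apply: symhat_eq => d /=.
rewrite !(@cauchy_trunc d.+1) //.
transitivity ((trunc d.+1 f * (trunc d.+1 g * trunc d.+1 h))`_d).
  rewrite coefM [RHS]coefM; apply: eq_bigr => i _; congr (_ * _).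
  have id : (d - i < d.+1)%N by rewrite ltnS leq_subr.
  by rewrite [LHS]coef_poly id; apply: cauchy_trunc.
rewrite mulrA coefM [RHS]coefM; apply: eq_bigr => i _; congr (_ * _).
by rewrite [RHS]coef_poly ltn_ord; apply/esym/cauchy_trunc.
Qed.

Fact symhat_mul1 : left_id symhat_one symhat_mul.
Proof.
move=> f; apply: symhat_eq => d /=; rewrite /cauchy big_ord_recl subn0.
rewrite /= /homog_one eqxx mul1r big1 ?addr0 // => i _.
by rewrite /= /bump /= add1n mul0r.
Qed.

Fact symhat_mulDl : left_distributive symhat_mul +%R.
Proof.
move=> f g h; apply: symhat_eq => d.
rewrite -[RHS]/(cauchy f h d + cauchy g h d) /= /cauchy -big_split /=.
by apply: eq_bigr => i _; rewrite -mulrDl.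
Qed.

Fact symhat_oner_neq0 : symhat_one != 0.
Proof.
apply/eqP => /(congr1 (fun f : symhat => f 0%N)) /eqP.
by rewrite /= /homog_one eqxx oner_eq0.
Qed.

HB.instance Definition _ := GRing.Zmodule_isComNzRing.Build symhat
  symhat_mulA symhat_mulC symhat_mul1 symhat_mulDl symhat_oner_neq0.

Fact symhat_scaleAl (c : k) (f g : symhat) : c *: (f * g) = c *: f * g.
Proof.
apply: symhat_eq => d.
rewrite -[LHS]/(c *: cauchy f g d) -[RHS]/(cauchy (c *: f) g d) /cauchy.
rewrite scaler_sumr.
by apply: eq_bigr => i _; rewrite -scalerAl.
Qed.

HB.instance Definition _ :=
  GRing.Lmodule_isLalgebra.Build k symhat symhat_scaleAl.
HB.instance Definition _ := GRing.Lalgebra_isComAlgebra.Build k symhat.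

Definition symhat_filt (N : nat) (f : symhat) : Prop :=
  forall d, (d < N)%N -> f d = 0.

Lemma dhomog_mderiv d (p : {mpoly k[n]}) i :
  p \is d.+1.-homog -> p^`M(i) \is d.-homog.
Proof.
move=> /dhomogP hp; rewrite /mderiv big_seq; apply: rpred_sum => m mp.
have [->|mi0] := eqVneq (m i) 0%N; first by rewrite mul0r scale0r rpred0.
apply: rpredZ; rewrite dhomogX /=; apply/eqP.
have mi : (U_(i) <= m)%MM by rewrite lep1mP.
have /= := hp _ mp; rewrite -{1}(submK mi) mdegD mdeg1 addn1.
by case.
Qed.

Lemma dhomog0_mderiv (p : {mpoly k[n]}) i : p \is 0.-homog -> p^`M(i) = 0.
Proof.
move=> /dhomogP hp; rewrite /mderiv big_seq big1 // => m mp.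
have /= /eqP := hp _ mp; rewrite mdeg_eq0 => /eqP ->.
by rewrite mnm0E mul0r scale0r.
Qed.

End CompletedSym.

Arguments homog_seq {k n}.

(* The variable 'X_i of the polynomial ring S(g) stands for the basis vector
   (vbasis {:g})`_i of g. *)
Section LiePoisson.
Variables (k : fieldType) (g : vectType k) (b : g -> g -> g).
Local Notation n := (\dim {:g}).
Local Notation e i := (vbasis {:g})`_i.

Definition linpoly (x : g) : {mpoly k[n]} := \sum_l crd l x *: 'X_l.

Definition lp_poly (p q : {mpoly k[n]}) : {mpoly k[n]} :=
  \sum_(i < n) \sum_(j < n) linpoly (b (e i) (e j)) * p^`M(i) * q^`M(j).

Definition lp_seq (f h : nat -> {mpoly k[n]}) : nat -> {mpoly k[n]} :=
  fun d => \sum_(i < d.+2) lp_poly (f i) (h (d.+1 - i)%N).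

Fact lp_homog (f h : symhat k n) : lp_seq f h \in homog_seq.
Proof.
apply/homog_seqP => d; apply: rpred_sum => -[i /= id] _.
apply: rpred_sum => j _; apply: rpred_sum => l _.
have fi := symhat_homog f i; have hi := symhat_homog h (d.+1 - i)%N.
case: i => [|i] in id fi hi *.
  by rewrite dhomog0_mderiv // mulr0 mul0r rpred0.
rewrite subSS in hi *; move: hi; case E: (d - i)%N => [|c] hi.
  by rewrite [X in _ * X]dhomog0_mderiv // mulr0 rpred0.
have -> : d = (1 + i + c)%N.
  by rewrite add1n addSn -addnS -E subnKC // -ltnS -ltnS ltnW // ltnS.
rewrite !dhomogM ?dhomog_mderiv //.
by apply: rpred_sum => m _; rewrite rpredZ // dhomogX /= mdeg1.
Qed.

Definition lie_poisson (f h : symhat k n) : symhat k n := SymHat (lp_homog f h).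

End LiePoisson.

(* For a Lie algebra a, U(a) is the quotient of the tensor algebra of a by the
   two-sided ideal generated by the x (x) y - y (x) x - [x, y].  A linear form
   on U(a) is therefore a linear form on the tensor algebra, i.e. a function f
   of finite sequences in a that is multilinear on sequences of each length
   (f [:: x1; ...; xm] being the value on the product x1 ... xm), which
   vanishes on this ideal. *)
Section EnvelopingDual.
Variables (k : fieldType) (a : lmodType k) (b : a -> a -> a).
Implicit Types (f h : seq a -> k^o) (u v w : seq a).

Definition is_envform f : Prop :=
  (forall u v, linear (fun x : a => f (u ++ x :: v)))
  /\ (forall u x y v,
        f (u ++ x :: y :: v) - f (u ++ y :: x :: v) = f (u ++ b x y :: v)).

Definition envform : {pred seq a -> k^o} := fun f => `[< is_envform f >].

Lemma envformP f : reflect (is_envform f) (f \in envform).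
Proof. exact: asboolP. Qed.

Fact envform_submod : submod_closed envform.
Proof.
split.
  apply/envformP; split=> [u v c x y|u x y v]; last exact: subr0.
  by apply/esym; rewrite -[LHS]/(c *: 0 + 0) scaler0 addr0.
move=> c f h /envformP[f1 f2] /envformP[h1 h2]; apply/envformP; split.
  move=> u v s x y; rewrite -[LHS]/(c *: f _ + h _) f1 h1.
  rewrite -[in RHS]/(s *: (c *: f _ + h _) + (c *: f _ + h _)).
  by rewrite !scalerDr !scalerA [c * s]mulrC addrACA.
move=> u x y v; rewrite -[RHS]/(c *: f _ + h _) -f2 -h2.
rewrite -[LHS]/(c *: f _ + h _ - (c *: f _ + h _)).
by rewrite scalerBr opprD addrACA.
Qed.

HB.instance Definition _ :=
  GRing.isSubmodClosed.Build k (seq a -> k^o) envform envform_submod.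

Record envdual := EnvDual {
  envdual_val :> seq a -> k^o;
  envdualP : envdual_val \in envform
}.

HB.instance Definition _ := [isSub for envdual_val].
HB.instance Definition _ := [Choice of envdual by <:].
HB.instance Definition _ := [SubChoice_isSubLmodule of envdual by <:].

Lemma envdual_eq (f h : envdual) : (forall w, f w = h w) -> f = h.
Proof. by move=> fh; apply/val_inj/funext. Qed.

Fact envform_ltrans u f : f \in envform -> (fun w => f (u ++ w)) \in envform.
Proof.
move=> /envformP[f1 f2]; apply/envformP; split.
  by move=> u' v s x y; rewrite !catA f1.
by move=> u' x y v; rewrite !catA f2.
Qed.

Fact envform_rtrans v f : f \in envform -> (fun w => f (w ++ v)) \in envform.
Proof.
move=> /envformP[f1 f2]; apply/envformP; split.
  by move=> u v' s x y; rewrite -!catA /= f1.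
by move=> u x y v'; rewrite -!catA /= f2.
Qed.

Definition ltrans u (f : envdual) : envdual :=
  EnvDual (envform_ltrans u (envdualP f)).
Definition rtrans v (f : envdual) : envdual :=
  EnvDual (envform_rtrans v (envdualP f)).

(* The coproduct of U(a), i.e. the algebra morphism such that
   x |-> x (x) 1 + 1 (x) x for x in a, evaluated on a product of elements of a
   and written as the list of its summands. *)
Fixpoint coprod w : seq (seq a * seq a) :=
  if w is x :: w' then
    [seq (x :: s.1, s.2) | s <- coprod w'] ++
    [seq (s.1, x :: s.2) | s <- coprod w']
  else [:: ([::], [::])].

Definition convol f h : seq a -> k^o :=
  fun w => \sum_(s <- coprod w) (f s.1 : k) * h s.2.

Definition counit : seq a -> k^o := fun w => (nilp w)%:R.

Let fctD f h w : (f + h) w = f w + h w. Proof. by []. Qed.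
Let fctN f w : (- f) w = - f w. Proof. by []. Qed.
Let fctZ c f w : (c *: f) w = c *: f w. Proof. by []. Qed.

Let lc x f : seq a -> k^o := fun w => f (x :: w).

Let convol_nil f h : convol f h [::] = (f [::] : k) * h [::].
Proof. by rewrite /convol /= big_seq1. Qed.

Let convol_cons f h x w :
  convol f h (x :: w) = convol (lc x f) h w + convol f (lc x h) w.
Proof. by rewrite /convol /= big_cat /= !big_map. Qed.

Let convol_lc f h x : lc x (convol f h) = convol (lc x f) h + convol f (lc x h).
Proof. by apply/funext => w; apply: convol_cons. Qed.

Let convolC f h : convol f h = convol h f.
Proof.
apply/funext => w; elim: w f h => [|x w IH] f h.
  by rewrite !convol_nil mulrC.
by rewrite !convol_cons addrC (IH f) (IH _ h).
Qed.

Let convol_linl h : linear (convol^~ h).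
Proof.
move=> c f f'; apply/funext => w.
rewrite -[RHS]/(c * convol f h w + convol f' h w) /convol.
rewrite mulr_sumr -big_split; apply: eq_bigr => s _ /=.
by rewrite -[(c *: f + f') _]/(c * f s.1 + f' s.1) mulrDl mulrA.
Qed.

Let convol_linr f : linear (convol f).
Proof. by move=> c h h'; rewrite !(convolC f) convol_linl. Qed.

Let convolDl f f' h : convol (f + f') h = convol f h + convol f' h.
Proof. by have := convol_linl h 1 f f'; rewrite !scale1r. Qed.

Let convolDr f h h' : convol f (h + h') = convol f h + convol f h'.
Proof. by rewrite convolC convolDl !(convolC f). Qed.

Let convolNl f h : convol (- f) h = - convol f h.
Proof.
have := convol_linl h (-1) f 0; rewrite !scaleN1r !addr0 => ->.
have : convol 0 h = 0 by apply: (@addrI _ (convol 0 h)); rewrite -convolDl !addr0.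
by move=> ->; rewrite addr0.
Qed.

Let convolNr f h : convol f (- h) = - convol f h.
Proof. by rewrite convolC convolNl convolC. Qed.

Let convolA f g h : convol f (convol g h) = convol (convol f g) h.
Proof.
apply/funext => w; elim: w f g h => [|x w IH] f g h.
  by rewrite !convol_nil mulrA.
rewrite !convol_cons !convol_lc convolDl convolDr.
by rewrite !fctD !IH addrA.
Qed.

Let lc_envform x f : f \in envform -> lc x f \in envform.
Proof. exact: (@envform_ltrans [:: x]). Qed.

Let lc_lin f : f \in envform -> linear (lc^~ f).
Proof. by move=> /envformP[f1 _] c x y; apply/funext => w; apply: (f1 [::] w). Qed.

Let lc_rel f x y : f \in envform -> lc y (lc x f) - lc x (lc y f) = lc (b x y) f.
Proof. by move=> /envformP[_ f2]; apply/funext => w; apply: (f2 [::]). Qed.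

Fact convol_envform f h :
  f \in envform -> h \in envform -> convol f h \in envform.
Proof.
move=> ff hh; apply/envformP; split => [u v|u x y v].
  elim: u f h ff hh => [|z u IH] f h ff hh c x y /=.
    rewrite !convol_cons !lc_lin // convol_linl convol_linr.
    by rewrite !(fctD, fctZ) scalerDr addrACA.
  rewrite !convol_cons (IH (lc z f) h) ?(IH f (lc z h)) ?lc_envform //.
  by rewrite scalerDr addrACA.
elim: u f h ff hh => [|z u IH] f h ff hh /=; last first.
  by rewrite !convol_cons -!IH ?lc_envform // opprD addrACA.
rewrite !convol_cons -!lc_rel // convolDl convolDr convolNl convolNr.
rewrite !(fctD, fctN).
have rearr (A A' B D E E' : k) :
  A + B + (D + E) - (A' + D + (B + E')) = A - A' + (E - E') by ring.
exact: rearr.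
Qed.

Fact counit_envform : counit \in envform.
Proof.
apply/envformP; split=> [u v c x y|u x y v]; rewrite /counit.
  by case: u => [|z u] /=; rewrite scaler0 addr0.
by case: u => [|z u] /=; rewrite subr0.
Qed.

Definition envdual_mul (f h : envdual) : envdual :=
  EnvDual (convol_envform (envdualP f) (envdualP h)).
Definition envdual_one : envdual := EnvDual counit_envform.

Fact envdual_mulA : associative envdual_mul.
Proof. by move=> f g h; apply/val_inj/convolA. Qed.

Fact envdual_mulC : commutative envdual_mul.
Proof. by move=> f h; apply/val_inj/convolC. Qed.

Let convol1 f : convol counit f = f.
Proof.
have lc1 x : lc x counit = 0 by apply/funext.
have convol0 h : convol 0 h = 0.
  by apply: (@addrI _ (convol 0 h)); rewrite -convolDl !addr0.
apply/funext => w; elim: w f => [|x w IH] f.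
  by rewrite convol_nil /counit mul1r.
by rewrite convol_cons lc1 convol0 add0r IH.
Qed.

Fact envdual_mul1 : left_id envdual_one envdual_mul.
Proof. by move=> f; apply/val_inj/convol1. Qed.

Fact envdual_mulDl : left_distributive envdual_mul +%R.
Proof. by move=> f g h; apply/val_inj/convolDl. Qed.

Fact envdual_oner_neq0 : envdual_one != 0.
Proof.
apply/eqP => /(congr1 (fun f : envdual => f [::])) /eqP.
by rewrite /= /counit oner_eq0.
Qed.

HB.instance Definition _ := GRing.Zmodule_isComNzRing.Build envdual
  envdual_mulA envdual_mulC envdual_mul1 envdual_mulDl envdual_oner_neq0.

Fact envdual_scaleAl (c : k) (f h : envdual) : c *: (f * h) = c *: f * h.
Proof.
apply/val_inj; have := convol_linl h c f 0.
have -> : convol 0 h = 0.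
  by apply: (@addrI _ (convol 0 h)); rewrite -convolDl !addr0.
by rewrite !addr0 => /esym.
Qed.

HB.instance Definition _ :=
  GRing.Lmodule_isLalgebra.Build k envdual envdual_scaleAl.
HB.instance Definition _ := GRing.Lalgebra_isComAlgebra.Build k envdual.

(* The N-th step is the annihilator of the span of the products of less than N
   elements of a.  For a finite dimensional, these annihilators form a basis of
   neighbourhoods of 0 for the weak topology of the dual U(a)^*. *)
Definition envdual_filt (N : nat) (f : envdual) : Prop :=
  forall w, (size w < N)%N -> f w = 0.

End EnvelopingDual.

(* The comultiplication of the formal group sends f to the function
   (u, v) |-> f (u ++ v) on U(a) (x) U(a), and is required to be a Poisson map
   for the product Poisson structure. *)
Definition is_multiplicative (k : fieldType) (a : lmodType k) (b : a -> a -> a)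
    (P : envdual b -> envdual b -> envdual b) : Prop :=
  forall (f h : envdual b) (u v : seq a),
    P f h (u ++ v) =
      \sum_(s <- coprod v) P (rtrans s.1 f) (rtrans s.2 h) u
      + \sum_(s <- coprod u) P (ltrans s.1 f) (ltrans s.2 h) v.

Section PoissonLie.
Variables (k : fieldType) (g : vectType k) (b : g -> g -> g).
Variable r : 'M[k]_(\dim {:g}).
Local Notation OGdual := (envdual (dual_bracket b r)).

(* The differential of f at the origin, a linear form on dual g, is x in g. *)
Definition has_differential (f : OGdual) (x : g) : Prop :=
  forall xi : dual g, f [:: xi] = xi x.

Record is_poisson_lie_bracket (P : OGdual -> OGdual -> OGdual) : Prop :=
  IsPoissonLieBracket {
    pl_poisson : is_poisson_bracket P;
    pl_multiplicative : is_multiplicative P;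
    pl_linearization : forall f h x y,
      has_differential f x -> has_differential h y ->
      has_differential (P f h) (b x y)
  }.

End PoissonLie.

Section FormalPoissonIso.
Variable k : fieldType.

Definition filt_continuous (A B : lmodType k) (FA : nat -> A -> Prop)
    (FB : nat -> B -> Prop) (phi : {linear A -> B}) : Prop :=
  forall N, exists M, forall x, FA M x -> FB N (phi x).

Definition formal_poisson_isomorphic (A B : comAlgType k)
    (FA : nat -> A -> Prop) (FB : nat -> B -> Prop)
    (PA : A -> A -> A) (PB : B -> B -> B) : Prop :=
  exists (phi : {lrmorphism A -> B}) (psi : {lrmorphism B -> A}),
    [/\ cancel phi psi, cancel psi phi,
        filt_continuous FA FB phi, filt_continuous FB FA psi
      & forall f h, phi (PA f h) = PB (phi f) (phi h)].

End FormalPoissonIso.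

(* Main.v *)
Require Import Defs.
From HB Require Import structures.
From mathcomp Require Import all_boot all_order all_algebra.
From mathcomp Require Import boolp functions.
From mathcomp Require Import mpoly ring zify.

(* The double d = g + g^* of a quasitriangular Lie bialgebra is the semidirect
   product g |x k, where k is g^* with the bracket [xi, eta] = ad^*_{t xi} eta.
   Hence D/G is both G^* and the formal group K of k; the exponential of K is
   equivariant under G, and identifies G^* with the formal vector space g^* in
   such a way that the dressing action rho of g becomes the coadjoint action.
   In these coordinates the Euler vector field eu commutes with rho.  The
   Poisson bivector pi of G^*, expressed in an invariant frame, is a 2-cocycle
   of g with values in power series; because eu commutes with rho, eu pi is
   the coboundary of the components of eu in this frame, so that, dividing by
   the degree, pi is itself the coboundary of a cochain E.  The corresponding
   vector field E = eu + (terms raising the degree) rescales the Poisson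
   bracket as eu rescales the linear one, and matching the eigenvectors of E
   with those of eu gives the Poisson isomorphism. *)

Set Implicit Arguments.
Unset Strict Implicit.
Unset Printing Implicit Defensive.

Import GRing.Theory.
Local Open Scope ring_scope.

(** * Formal power series *)

(** The Yang-Baxter equation makes r : g^* -> g a morphism of Lie algebras, so that the elements xi
    - r xi form an ideal of the double complementary to g; invariance of t is what turns ad^*_{t xi}
    eta into a Lie bracket. No group is ever built. The groups enter only through vector fields on
    formal series, where e_i acts as [- rho i] and the dual vector e^j as [par j]; this assignment
    reverses brackets, whence the minus signs in the commutation relations. Integration is replaced
    by contraction for the degree filtration: an object is the fixed point of a map that gains a
    degree, and an identity holds because its defect z satisfies an equation (eu + m) z = (terms of
    higher order in z), with eu + m invertible in characteristic 0 (off the constants when m = 0).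
    The bracket of G^* is given only by its properties. Multiplicativity and linearization force its
    values on all words, and these are compared with the values of an explicit bracket. *)

Section FormalSeries.
Variables (k : fieldType) (n : nat).
Local Notation A := (symhat k n).
Implicit Types (f g h : A) (c : k) (d N : nat) (i j : 'I_n).

Lemma symhat0E d : (0 : A) d = 0. Proof. by []. Qed.
Lemma symhatDE f g d : (f + g) d = f d + g d. Proof. by []. Qed.
Lemma symhatNE f d : (- f) d = - f d. Proof. by []. Qed.
Lemma symhatBE f g d : (f - g) d = f d - g d. Proof. by []. Qed.
Lemma symhatZE c f d : (c *: f) d = c *: f d. Proof. by []. Qed.
Lemma symhat1E d : (1 : A) d = (d == 0%N)%:R. Proof. by []. Qed.
Lemma symhatME f g d : (f * g) d = \sum_(i < d.+1) f i * g (d - i)%N.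
Proof. by []. Qed.

Fact pd_subproof i f : (fun d => (f d.+1)^`M(i)) \in @homog_seq k n.
Proof. by apply/homog_seqP => d; rewrite dhomog_mderiv ?symhat_homog. Qed.

Definition pd i f : A := SymHat (pd_subproof i f).

Lemma pdE i f d : pd i f d = (f d.+1)^`M(i). Proof. by []. Qed.

Fact pd_linear i : linear (pd i).
Proof.
by move=> c f g; apply: symhat_eq => d; rewrite pdE !symhatDE !symhatZE mderivD
  mderivZ.
Qed.
HB.instance Definition _ i := GRing.isLinear.Build k A A _ (pd i) (pd_linear i).

Lemma pdM i f g : pd i (f * g) = pd i f * g + f * pd i g.
Proof.
apply: symhat_eq => d; rewrite pdE symhatDE !symhatME raddf_sum /=.
under eq_bigr do rewrite mderivM.
rewrite big_split /= big_ord_recl /= dhomog0_mderiv ?symhat_homog // mul0r add0r.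
congr (_ + _); rewrite big_ord_recr /= subnn.
rewrite [X in _ * X]dhomog0_mderiv ?symhat_homog // mulr0 addr0.
by apply: eq_bigr => j _; rewrite subSn // -ltnS.
Qed.

Lemma pdC i j f : pd i (pd j f) = pd j (pd i f).
Proof. by apply: symhat_eq => d; rewrite !pdE mderiv_comm. Qed.

Fact eu_subproof f : (fun d => d%:R *: f d) \in @homog_seq k n.
Proof. by apply/homog_seqP => d; rewrite rpredZ ?symhat_homog. Qed.

Definition eu f : A := SymHat (eu_subproof f).

Lemma euE f d : eu f d = d%:R *: f d. Proof. by []. Qed.

Fact eu_linear : linear eu.
Proof.
move=> c f g; apply: symhat_eq => d; rewrite euE !symhatDE !symhatZE scalerDr
  !scalerA mulrC.
by [].
Qed.
HB.instance Definition _ := GRing.isLinear.Build k A A _ eu eu_linear.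

Lemma euM f g : eu (f * g) = eu f * g + f * eu g.
Proof.
apply: symhat_eq => d; rewrite euE symhatDE !symhatME scaler_sumr -big_split /=.
apply: eq_bigr => i _; rewrite -scalerAl -scalerAr -scalerDl -natrD.
by rewrite subnKC // -ltnS.
Qed.

Lemma eu_pd i f : eu (pd i f) = pd i (eu f) - pd i f.
Proof.
apply: symhat_eq => d; rewrite symhatBE !(euE, pdE) mderivZ mulrS scalerDl
  scale1r.
by rewrite addrC addKr.
Qed.

Fact ieu_subproof m f : (fun d => ((d + m)%:R)^-1 *: f d) \in @homog_seq k n.
Proof. by apply/homog_seqP => d; rewrite rpredZ ?symhat_homog. Qed.

(* The inverse of [eu + m]; it kills the component of degree 0 when [m = 0]. *)
Definition ieu m f : A := SymHat (ieu_subproof m f).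

Lemma ieuE m f d : ieu m f d = ((d + m)%:R)^-1 *: f d. Proof. by []. Qed.

Fact ieu_linear m : linear (ieu m).
Proof.
move=> c f g; apply: symhat_eq => d; rewrite ieuE !symhatDE !symhatZE scalerDr
  !scalerA mulrC.
by [].
Qed.
HB.instance Definition _ m := GRing.isLinear.Build k A A _ (ieu m) (ieu_linear m).

Fact symhat_X_subproof i : (fun d => if d == 1%N then 'X_i else 0) \in
  @homog_seq k n.
Proof.
apply/homog_seqP => d; case: eqP => [->|_]; last exact: rpred0.
by rewrite dhomogX /= mdeg1.
Qed.
Definition symhat_X i : A := SymHat (symhat_X_subproof i).

Lemma symhat_XE i d : symhat_X i d = if d == 1%N then 'X_i else 0. Proof. by [].
  Qed.

Lemma pd_X i j : pd i (symhat_X j) = (i == j)%:R.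
Proof.
apply: symhat_eq => d; rewrite pdE symhat_XE eqSS.
case: d => [|d] /=; last by rewrite mderiv0; case: (i == j).
rewrite mderivX mnm1E eq_sym; case: eqVneq => [->|_]; last by rewrite scale0r.
rewrite scale1r -[RHS]mpolyX0; congr ('X_[_]).
by apply/mnmP => l; rewrite !mnmE subnn.
Qed.

Lemma homog_euler d (p : {mpoly k[n]}) :
  p \is d.-homog -> \sum_i 'X_i * p^`M(i) = d%:R *: p.
Proof.
move=> /dhomogP hp; rewrite {2}[p]mpolyE scaler_sumr.
under eq_bigr do rewrite /mderiv mulr_sumr.
rewrite exchange_big /=; apply: eq_big_seq => m mp.
have <- : mdeg m = d := hp _ mp.
rewrite mdegE natr_sum scaler_suml; apply: eq_bigr => i _.
have [->|mi] := eqVneq (m i) 0%N; first by rewrite !(mulr0, mul0r, scale0r).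
rewrite -scalerAr -mpolyXD addmC submK ?lep1mP // scalerA mulrC.
by [].
Qed.

Lemma eu_euler f : eu f = \sum_i symhat_X i * pd i f.
Proof.
apply: symhat_eq => d; rewrite euE -(homog_euler (symhat_homog f d)).
rewrite (big_morph (fun h : A => h d) (fun f g => symhatDE f g d) (symhat0E d)).
apply: eq_bigr => i _; rewrite symhatME; case: d => [|d].
  by rewrite big_ord1 symhat_XE /= mul0r dhomog0_mderiv ?symhat_homog // mulr0.
rewrite big_ord_recl big_ord_recl big1 => [|j _]; last first.
  by rewrite symhat_XE /= mul0r.
by rewrite !symhat_XE /= mul0r add0r addr0 subn1.
Qed.

(** * The degree filtration and its contraction principles *)

Local Notation fil := (@symhat_filt k n).

Lemma fil0 f : fil 0 f. Proof. by []. Qed.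

Lemma fil_le M N f : (M <= N)%N -> fil N f -> fil M f.
Proof. by move=> MN fN d dM; apply: fN; apply: leq_trans dM MN. Qed.

Lemma filD N f g : fil N f -> fil N g -> fil N (f + g).
Proof. by move=> fN gN d dN; rewrite symhatDE fN // gN // addr0. Qed.

Lemma filN N f : fil N f -> fil N (- f).
Proof. by move=> fN d dN; rewrite symhatNE fN // oppr0. Qed.

Lemma filB N f g : fil N f -> fil N g -> fil N (f - g).
Proof. by move=> fN gN; apply/filD/filN. Qed.

Lemma filZ N c f : fil N f -> fil N (c *: f).
Proof. by move=> fN d dN; rewrite symhatZE fN // scaler0. Qed.

Lemma fil_sum (I : Type) (s : seq I) (Q : pred I) (F : I -> A) N :
  (forall x, Q x -> fil N (F x)) -> fil N (\sum_(x <- s | Q x) F x).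
Proof. by move=> FN; elim/big_ind: _ => // f g; apply: filD. Qed.

Lemma filM M N f g : fil M f -> fil N g -> fil (M + N) (f * g).
Proof.
move=> fM gN d dMN; rewrite symhatME big1 // => -[i /= id] _.
have [iM|iM] := ltnP i M; first by rewrite fM // mul0r.
rewrite gN ?mulr0 // ltn_subLR -1?ltnS //.
by apply: leq_trans dMN _; rewrite leq_add2r.
Qed.

Lemma filMl M N f g : (M <= N)%N -> fil N f -> fil M (f * g).
Proof. by move=> MN fN; apply: (fil_le MN); rewrite -[N]addn0; apply: filM. Qed.

Lemma filMr M N f g : (M <= N)%N -> fil N g -> fil M (f * g).
Proof. by move=> MN gN; rewrite mulrC; apply: filMl gN. Qed.

Lemma fil_pd N i f : fil N.+1 f -> fil N (pd i f).
Proof. by move=> fN d dN; rewrite pdE fN // mderiv0. Qed.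

Lemma fil_eu N f : fil N f -> fil N (eu f).
Proof. by move=> fN d dN; rewrite euE fN // scaler0. Qed.

Lemma fil_ieu m N f : fil N f -> fil N (ieu m f).
Proof. by move=> fN d dN; rewrite ieuE fN // scaler0. Qed.

Lemma fil_X i : fil 1 (symhat_X i).
Proof. by case. Qed.

Lemma fil_eq0 f : (forall N, fil N f) -> f = 0.
Proof. by move=> fN; apply: symhat_eq => d; apply: (fN d.+1). Qed.

Lemma fil1P f : f 0%N = 0 -> fil 1 f.
Proof. by move=> f0 [|d]. Qed.

(** Uniqueness principle for a family whose members are tied by an equation: they gain a degree all
    together, hence the index type [I]. *)
Lemma contraction_eq0 (I : Type) (z : I -> A) :
  (forall N, (forall x, fil N (z x)) -> forall x, fil N.+1 (z x)) ->
  forall x, z x = 0.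
Proof.
move=> zN x; apply: fil_eq0 => N; move: x.
by elim: N => [|N IH] x; [apply: fil0 | apply: zN].
Qed.

(** Fixed point theorem for the degree filtration. Starting from 0, the component of degree d no
    longer changes after d + 1 iterations, so the limit takes it from that iterate. *)
Lemma contraction_fix (I : Type) (Phi : (I -> A) -> I -> A) :
  (forall N u v, (forall x, fil N (u x - v x)) ->
     forall x, fil N.+1 (Phi u x - Phi v x)) ->
  exists u, forall x, Phi u x = u x.
Proof.
move=> PhiN; pose w N : I -> A := iter N Phi (fun=> 0).
have w_step N x : fil N (w N.+1 x - w N x).
  by elim: N x => [|N IH] x; [apply: fil0 | apply: PhiN].
have w_cauchy N M x : (N <= M)%N -> fil N (w M x - w N x).
  move=> /subnK <-; elim: (M - N)%N => [|m IH]; first by rewrite add0n subrr.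
  rewrite -[X in fil _ X](subrKA (w (m + N)%N x)); apply: filD IH.
  by apply: fil_le (w_step _ _); rewrite leq_addl.
have u_homog x : (fun d => w d.+1 x d) \in @homog_seq k n.
  by apply/homog_seqP => d; apply: symhat_homog.
pose u x : A := SymHat (u_homog x).
have uw N x : fil N (u x - w N x).
  move=> d dN; rewrite symhatBE; apply/eqP; rewrite subr_eq0 eq_sym -subr_eq0.
  by rewrite -symhatBE; apply/eqP/(w_cauchy d.+1 N x dN d).
exists u => x; apply/eqP; rewrite -subr_eq0; apply/eqP/fil_eq0 => N.
apply: (@fil_le _ N.+1) => //.
rewrite -[X in fil _ X](subrKA (w N.+1 x)); apply: filD; first exact: PhiN.
by rewrite -opprB; apply/filN/uw.
Qed.

Section Char0.
Hypothesis char0 : [pchar k] =i pred0.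

Lemma natf_eq0 d : (d%:R == 0 :> k) = (d == 0%N).
Proof. exact: (proj1 (pcharf0P k) char0). Qed.

Lemma natf_eq d m : (d%:R == m%:R :> k) = (d == m).
Proof.
wlog dm : d m / (d <= m)%N => [H|].
  by case: (leqP d m) => [/H//|/ltnW/H]; rewrite eq_sym [RHS]eq_sym.
by rewrite eq_sym -subr_eq0 -natrB // natf_eq0 subn_eq0 eqn_leq dm.
Qed.

Lemma ieuK m f : (0 < m)%N -> ieu m (eu f + f *+ m) = f.
Proof.
move=> m0; apply: symhat_eq => d.
rewrite -scaler_nat ieuE symhatDE euE symhatZE -scalerDl -natrD scalerA mulVf
  ?scale1r //.
by rewrite natf_eq0 addn_eq0 (gtn_eqF m0) andbF.
Qed.

Lemma eu_ieu m f : (0 < m)%N -> eu (ieu m f) + ieu m f *+ m = f.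
Proof.
move=> m0; apply: symhat_eq => d.
rewrite -scaler_nat symhatDE symhatZE euE ieuE -scalerDl -natrD scalerA mulfV
  ?scale1r //.
by rewrite natf_eq0 addn_eq0 (gtn_eqF m0) andbF.
Qed.

Lemma ieu0K f : fil 1 f -> ieu 0 (eu f) = f.
Proof.
move=> f1; apply: symhat_eq => -[|d].
  by rewrite ieuE euE f1 // !scaler0.
by rewrite ieuE euE addn0 scalerA mulVf ?scale1r // natf_eq0.
Qed.

Lemma eu_ieu0 f : fil 1 f -> eu (ieu 0 f) = f.
Proof.
move=> f1; apply: symhat_eq => -[|d].
  by rewrite euE ieuE f1 // !scaler0.
by rewrite euE ieuE addn0 scalerA mulfV ?scale1r // natf_eq0.
Qed.

Lemma fil_eu_inv N f : fil 1 f -> fil N (eu f) -> fil N f.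
Proof. by move=> f1 fN; rewrite -(ieu0K f1); apply: fil_ieu. Qed.

Lemma fil_euS_inv m N f : (0 < m)%N -> fil N (eu f + f *+ m) -> fil N f.
Proof. by move=> m0 fN; rewrite -(ieuK f m0); apply: fil_ieu. Qed.

End Char0.

Definition ev f : k^o := (f 0%N)@_0%MM.

Lemma ev_linear : linear ev.
Proof. by move=> c f g; rewrite /ev symhatDE symhatZE mcoeffD mcoeffZ. Qed.
HB.instance Definition _ := GRing.isLinear.Build k A k^o _ ev ev_linear.

Lemma evM f g : ev (f * g) = (ev f : k) * ev g.
Proof. by rewrite /ev symhatME big_ord1 subn0 (mcoeff0_is_multiplicative n k).1.
  Qed.

Lemma ev1 : ev 1 = 1.
Proof. by rewrite /ev symhat1E mcoeff1 eqxx. Qed.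

Lemma fil1_ev f : fil 1 f <-> ev f = 0.
Proof.
split=> [f1|f0]; first by rewrite /ev f1 // mcoeff0.
apply: fil1P; apply/mpolyP => m; rewrite mcoeff0.
have [->//|m0] := eqVneq m 0%MM.
apply: (dhomog_nemf_coeff (symhat_homog f 0)).
by rewrite mdeg_eq0.
Qed.

Lemma mulr_sumZ f (c : 'I_n -> k) (F : 'I_n -> A) :
  f * (\sum_i c i *: F i) = \sum_i c i *: (f * F i).
Proof. by rewrite mulr_sumr; apply: eq_bigr => i _; rewrite scalerAr. Qed.

(** * Formal vector fields *)

Section VectorFields.
Implicit Types v w : 'I_n -> A.

Definition vf v f : A := \sum_i v i * pd i f.

Fact vf_linear v : linear (vf v).
Proof.
move=> c f g; rewrite /vf scaler_sumr -big_split; apply: eq_bigr => i _ /=.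
by rewrite linearP mulrDr scalerAr.
Qed.
HB.instance Definition _ v := GRing.isLinear.Build k A A _ (vf v) (vf_linear v).

Lemma vfM v f g : vf v (f * g) = vf v f * g + f * vf v g.
Proof.
rewrite /vf mulr_suml mulr_sumr -big_split; apply: eq_bigr => i _ /=.
by rewrite pdM; ring.
Qed.

Lemma vf_X v i : vf v (symhat_X i) = v i.
Proof.
rewrite /vf (bigD1 i) //= pd_X eqxx mulr1 big1 ?addr0 // => j ji.
by rewrite pd_X (negPf ji) mulr0.
Qed.

Lemma vfC v w f :
  vf v (vf w f) - vf w (vf v f) = vf (fun i => vf v (w i) - vf w (v i)) f.
Proof.
have E (a c : 'I_n -> A) : vf a (vf c f) =
    \sum_i vf a (c i) * pd i f + \sum_i \sum_j c i * a j * pd i (pd j f).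
  rewrite {2}/vf raddf_sum -big_split; apply: eq_bigr => i _ /=.
  rewrite vfM; congr (_ + _); rewrite [in LHS]/vf mulr_sumr.
  by apply: eq_bigr => j _; rewrite pdC mulrA.
rewrite !E [X in _ + X - _]exchange_big /= addrC opprD addrACA.
rewrite [X in _ + X = _](_ : _ = 0) ?addr0; last first.
  rewrite addrC; apply/eqP; rewrite subr_eq0; apply/eqP.
  apply: eq_bigr => i _; apply: eq_bigr => j _.
  by rewrite pdC [v _ * _]mulrC.
by rewrite addrC -sumrB; apply: eq_bigr => i _; rewrite mulrBl.
Qed.

Lemma fil_vf N v f : fil N.+1 f -> fil N (vf v f).
Proof. by move=> fN; apply: fil_sum => i _; apply/filMr/fil_pd/fN. Qed.

Lemma fil_vf1 M N v f :
  (forall i, fil M.+1 (v i)) -> fil N f -> fil (M + N) (vf v f).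
Proof.
case: N => [|N] vM fN; apply: fil_sum => i _.
  by rewrite addn0; apply: filMl (vM i).
by rewrite -addSnnS; apply: filM; [apply: vM | apply: fil_pd].
Qed.

End VectorFields.

End FormalSeries.

(** * Exponential coordinates *)

Section LinearVectorFields.
Variables (k : fieldType) (n : nat) (a : 'M[k]_n).
Local Notation A := (symhat k n).
Definition lvf : 'I_n -> A := fun j => \sum_l a j l *: symhat_X k l.

Lemma eu_X (i : 'I_n) : eu (symhat_X k i) = symhat_X k i.
Proof.
apply: symhat_eq => d; rewrite euE symhat_XE; case: eqP => [->|_]; first exact:
  scale1r.
exact: scaler0.
Qed.

Lemma fil_lvf j : symhat_filt 1 (lvf j).
Proof. by apply: fil_sum => l _; apply/filZ/fil_X. Qed.

Lemma vf_lvf v j : vf v (lvf j) = \sum_l a j l *: v l.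
Proof. by rewrite raddf_sum; apply: eq_bigr => l _ /=; rewrite linearZ /= vf_X.
  Qed.

(** The degree lost in [pd] is restored by the linear coefficient, so a linear field preserves
    degrees. *)
Lemma eu_vf_lvf f : eu (vf lvf f) = vf lvf (eu f).
Proof.
rewrite /vf raddf_sum; apply: eq_bigr => j _ /=.
have lvfE : eu (lvf j) = lvf j.
  by rewrite raddf_sum; apply: eq_bigr => l _ /=; rewrite linearZ /= eu_X.
by rewrite euM eu_pd lvfE mulrBr addrC subrK.
Qed.

End LinearVectorFields.

Lemma vf_lvf_lvf (k : fieldType) (n : nat) (a b : 'M[k]_n) j :
  vf (lvf a) (lvf b j) = lvf (b *m a) j.
Proof.
rewrite vf_lvf; under eq_bigr do rewrite scaler_sumr.
rewrite exchange_big; apply: eq_bigr => l _; rewrite mxE scaler_suml.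
by apply: eq_bigr => m _; rewrite scalerA.
Qed.

(** Composing linear fields on coordinates reverses the product of their matrices, hence the
    exchanged commutator. *)
Lemma vf_lvfC (k : fieldType) (n : nat) (a b : 'M[k]_n) f :
  vf (lvf a) (vf (lvf b) f) - vf (lvf b) (vf (lvf a) f) =
  vf (lvf (b *m a - a *m b)) f.
Proof.
rewrite vfC; apply: eq_bigr => j _; congr (_ * _).
rewrite !vf_lvf_lvf /lvf -sumrB; apply: eq_bigr => l _.
by rewrite -scalerBl !mxE.
Qed.

(** * Matrices of power series and derivations *)

Section MatrixSeries.
Variables (k : fieldType) (n : nat).
Local Notation A := (symhat k n).
Local Notation fil := (@symhat_filt k n).

Lemma contraction_fix_mx p q (Phi : 'M[A]_(p, q) -> 'M[A]_(p, q)) :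
  (forall N (U V : 'M[A]_(p, q)), (forall i j, fil N (U i j - V i j)) ->
     forall i j, fil N.+1 (Phi U i j - Phi V i j)) ->
  exists U, Phi U = U.
Proof.
move=> PhiN; pose mx (u : 'I_p * 'I_q -> A) : 'M[A]_(p, q) := \matrix_(i, j) u
  (i, j).
have [|u uP] := @contraction_fix k n _ (fun u x => Phi (mx u) x.1 x.2).
  by move=> N u v uvN x; apply: PhiN => i j; rewrite !mxE.
by exists (mx u); apply/matrixP => i j; rewrite [RHS]mxE -uP.
Qed.

(** Neumann series: W is the fixed point of W = 1 + (1 - U) W, a contraction since 1 - U has no
    constant term. *)
Lemma right_inverse_mx (U : 'M[A]_n) :
  (forall i j, fil 1 (U i j - (i == j)%:R)) -> exists W, U *m W = 1%:M.
Proof.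
move=> U1; have [|W WE] := @contraction_fix_mx n n (fun W => 1%:M + (1%:M - U)
  *m W).
  move=> N V W VW i j.
  have -> (B C D : 'M[A]_n) : (B + C) i j - (B + D) i j = (C - D) i j.
    by rewrite !mxE opprD addrACA subrr add0r.
  rewrite -mulmxBr mxE; apply: fil_sum => l _; rewrite -add1n; apply: filM; last
    first.
    by rewrite !mxE; apply: VW.
  by rewrite !mxE -opprB; apply: filN.
exists W; move/eqP: WE; rewrite mulmxBl mul1mx addrCA -subr_eq0 addrAC subrr
  add0r.
by rewrite subr_eq0 => /eqP ->.
Qed.

Section Derivations.
Variables (D : {linear A -> A}).
Hypothesis DM : forall f g, D (f * g) = D f * g + f * D g.

Lemma der_nat m : D m%:R = 0.
Proof.
suff D1 : D 1 = 0 by rewrite raddfMn /= D1 mul0rn.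
by apply: (@addrI _ (D 1)); rewrite addr0 -{3}[1]mulr1 DM mulr1 mul1r.
Qed.

Lemma der_mulmx p q s (U : 'M[A]_(p, q)) (V : 'M[A]_(q, s)) :
  map_mx D (U *m V) = map_mx D U *m V + U *m map_mx D V.
Proof.
apply/matrixP => i j; rewrite !mxE raddf_sum -big_split; apply: eq_bigr => l _ /=.
by rewrite DM !mxE.
Qed.

Lemma der_scalar_mx p m : map_mx D (m%:R%:M : 'M[A]_p) = 0.
Proof.
by apply/matrixP => i j; rewrite !mxE raddfMn /= der_nat mul0rn.
Qed.

Lemma der_inv (U V : 'M[A]_n) : V *m U = 1%:M ->
  map_mx D V = - (V *m map_mx D U *m V).
Proof.
move=> VU; have UV := mulmx1C VU.
have := der_mulmx V U; rewrite VU (der_scalar_mx n 1) => /eqP.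
rewrite eq_sym addr_eq0 => /eqP /(congr1 (mulmx^~ V)).
by rewrite -mulmxA UV mulmx1 mulNmx.
Qed.

End Derivations.
End MatrixSeries.

(** * The Maurer-Cartan form in exponential coordinates *)

Section MaurerCartan.
Variables (k : fieldType) (n : nat).
Hypothesis char0 : [pchar k] =i pred0.
Local Notation A := (symhat k n).
Local Notation fil := (@symhat_filt k n).

Variable c : 'I_n -> 'I_n -> 'I_n -> k.
Hypothesis c_anti : forall i j l, c i j l = - c j i l.
Hypothesis c_jacobi : forall i j p q,
  \sum_m c j p m * c i m q =
  \sum_m c i j m * c m p q + \sum_m c i p m * c j m q.

Implicit Types u v w : 'rV[A]_n.

(* Right multiplication by ad_mx u is the bracket with u in A (x) V, where V is
   the Lie algebra with structure constants c. *)
Definition ad_mx u : 'M[A]_n := \matrix_(j, l) \sum_i c i j l *: u 0 i.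

Fact ad_mx_linear : linear ad_mx.
Proof.
move=> a u v; apply/matrixP => j l; rewrite !mxE mulr_sumr -big_split.
by apply: eq_bigr => i _; rewrite !mxE scalerDr scalerAr.
Qed.
HB.instance Definition _ :=
  GRing.isLinear.Build A 'rV[A]_n 'M[A]_n _ ad_mx ad_mx_linear.

Lemma ad_mx_anti u v : v *m ad_mx u = - (u *m ad_mx v).
Proof.
apply/rowP => l; rewrite !mxE; under eq_bigr do rewrite mxE mulr_sumr.
rewrite exchange_big -sumrN; apply: eq_bigr => i _.
rewrite mxE mulr_sumr -sumrN; apply: eq_bigr => j _.
by rewrite c_anti scaleNr mulrN -!scalerAr mulrC.
Qed.

Lemma ad_mx_jacobi u v : ad_mx (v *m ad_mx u) = ad_mx v *m ad_mx u - ad_mx u *m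
  ad_mx v.
Proof.
have E (a b : 'rV[A]_n) j q : (ad_mx a *m ad_mx b) j q =
    \sum_i \sum_p (\sum_m c p j m * c i m q) *: (b 0 i * a 0 p).
  rewrite mxE; under eq_bigr => m do rewrite !mxE big_distrlr /=.
  rewrite exchange_big; under eq_bigr => p do rewrite exchange_big /=.
  rewrite exchange_big; apply: eq_bigr => i _.
  apply: eq_bigr => p _; rewrite scaler_suml.
  by apply: eq_bigr => m _; rewrite -scalerAl -scalerAr scalerA [a _ _ * _]mulrC.
apply/matrixP => j q; rewrite [in RHS]mxE [X in _ + X]mxE !E [X in _ -
  X]exchange_big.
rewrite -sumrB mxE; under eq_bigr => m do rewrite mxE scaler_sumr.
under eq_bigr => m do under eq_bigr => p do rewrite mxE mulr_sumr scaler_sumr.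
under eq_bigr => m do rewrite exchange_big /=.
rewrite [LHS]exchange_big; apply: eq_bigr => i _ /=.
rewrite -sumrB [LHS]exchange_big; apply: eq_bigr => p _ /=.
rewrite c_jacobi scalerDl [v _ _ * _]mulrC addrK scaler_suml.
by apply: eq_bigr => m _; rewrite -scalerAr scalerA [v _ _ * _]mulrC [_ * c _ _
  _]mulrC.
Qed.

Lemma der_ad_mx (D : {linear A -> A}) u : map_mx D (ad_mx u) = ad_mx (map_mx D u).
Proof.
apply/matrixP => j l; rewrite !mxE raddf_sum; apply: eq_bigr => i _ /=.
by rewrite linearZ mxE.
Qed.

(** The tautological element X of A (x) V, the argument of the power series in ad X. *)
Definition gen_pt : 'rV[A]_n := \row_i symhat_X k i.

Lemma fil_ad_gen_pt i j : fil 1 (ad_mx gen_pt i j).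
Proof. by rewrite mxE; apply: fil_sum => l _; rewrite mxE; apply/filZ/fil_X. Qed.

(* theta = (1 - exp (- ad X)) / ad X, the Maurer-Cartan form of the group with
   Lie algebra V in exponential coordinates. *)
Lemma mc_form_exists : exists th : 'M[A]_n,
  map_mx (@eu k n) th + th = 1%:M - th *m ad_mx gen_pt.
Proof.
have [|th thE] := @contraction_fix_mx k n n n
    (fun th => map_mx (@ieu k n 1) (1%:M - th *m ad_mx gen_pt)).
  move=> N U V UV i j; rewrite !mxE -raddfB; apply: fil_ieu.
  rewrite opprD addrACA subrr add0r -opprD; apply: filN.
  rewrite -sumrB; apply: fil_sum => l _; rewrite -mulrBl -addn1.
  by apply: filM => //; apply: fil_ad_gen_pt.
exists th; rewrite -[in LHS]thE; move: (1%:M - _) => Y.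
apply/matrixP => i j; rewrite !mxE.
by rewrite -[X in _ + X]mulr1n eu_ieu.
Qed.

Variable th : 'M[A]_n.
(** This is d/ds (s th(sX)) = exp (- s ad X) at s = 1, with the exponential eliminated as 1 - th ad
    X. Flatness and equivariance of [th] are both deduced from this radial equation alone. *)
Hypothesis th_eu : map_mx (@eu k n) th + th = 1%:M - th *m ad_mx gen_pt.

Lemma th_fil i j : fil 1 (th i j - (i == j)%:R).
Proof.
apply: (@fil_euS_inv _ _ char0 1) => //; rewrite mulr1n.
have := congr1 (fun U : 'M_n => U i j) th_eu; rewrite /= [LHS]mxE [X in X + _]mxE.
rewrite [RHS]mxE [X in _ = X + _]mxE => thE.
rewrite raddfB /= (der_nat (@euM k n)) subr0 addrA thE.
rewrite !mxE addrAC subrr add0r; apply/filN.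
by apply: fil_sum => l _; apply: filMr (fil_ad_gen_pt _ _).
Qed.

Lemma eu_row i : map_mx (@eu k n) (row i th) =
  delta_mx 0 i - row i th *m ad_mx gen_pt - row i th.
Proof.
apply: (canRL (addrK _)); rewrite -row1 -row_mul -!(raddfB, raddfD) /= -th_eu.
by apply/rowP => j; rewrite !mxE.
Qed.

Lemma pd_gen_pt i : map_mx (@pd k n i) gen_pt = delta_mx 0 i.
Proof.
by apply/rowP => j; rewrite !mxE pd_X eqxx eq_sym.
Qed.

Lemma der_delta (D : {linear A -> A}) (i : 'I_n) :
  (forall f g, D (f * g) = D f * g + f * D g) -> map_mx D (delta_mx 0 i : 'rV_n)
    = 0.
Proof. by move=> DM; apply/rowP => j; rewrite !mxE der_nat. Qed.

(** The curvature of [th] on the coordinate fields i and j; with the convention of [ad_mx] the last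
    term is the bracket of [row i th] with [row j th]. *)
Definition curv i j : 'rV[A]_n :=
  map_mx (pd i) (row j th) - map_mx (pd j) (row i th)
  + row j th *m ad_mx (row i th).

(** The left side is the Lie derivative along [eu] of a two-form: each of the two covector indices
    adds one to the weight. Expanding it with [th_eu] and the Jacobi identity gives back the
    curvature. *)
Lemma eu_curv i j :
  map_mx (@eu k n) (curv i j) + curv i j *+ 2 = - (curv i j *m ad_mx gen_pt).
Proof.
have eu_pd_row a b : map_mx (@eu k n) (map_mx (pd a) (row b th)) =
    - (row b th *m ad_mx (delta_mx 0 a)) - map_mx (pd a) (row b th) *m ad_mx
      gen_pt
    - map_mx (pd a) (row b th) *+ 2.
  have -> : map_mx (@eu k n) (map_mx (pd a) (row b th)) =
      map_mx (pd a) (map_mx (@eu k n) (row b th)) - map_mx (pd a) (row b th).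
    by apply/rowP => l; rewrite !mxE eu_pd.
  rewrite eu_row !raddfB /= (der_delta _ (pdM a)) sub0r (der_mulmx (pdM a)).
  rewrite der_ad_mx pd_gen_pt opprD mulr2n opprD addrA.
  by rewrite [X in X - _ - _]addrC.
rewrite /curv raddfD raddfB /= !eu_pd_row (der_mulmx (@euM k n)) der_ad_mx.
rewrite !eu_row !raddfB /= ad_mx_jacobi !mulmxBl !mulmxBr !mulmxDl mulNmx.
rewrite (ad_mx_anti (row i th) (delta_mx 0 j)) !mulmxA.
(* With all matrix products made opaque, the identity is additive and holds entrywise. *)
move: (_ *m ad_mx (row i th) *m _) (_ *m _ *m ad_mx (row i th)).
move: (_ *m ad_mx (row i th)) (_ *m ad_mx (delta_mx 0 i)) (_ *m ad_mx (delta_mx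
  0 j)).
move: (map_mx _ (row j th) *m _) (map_mx _ (row i th) *m _).
move: (map_mx _ (row j th)) (map_mx _ (row i th)) => x1 x2 x3 x4 x5 x6 x7 x8 x9.
by apply/rowP => l; rewrite !mxE; ring.
Qed.

(** In [eu_curv] the factor ad X has no constant term, so the curvature gains a degree at each
    pass. *)
Lemma curv_eq0 i j : curv i j = 0.
Proof.
apply/rowP => l; rewrite [RHS]mxE.
pose z (x : 'I_n * 'I_n * 'I_n) := curv x.1.1 x.1.2 0 x.2.
have z0 : forall x, z x = 0; last exact: (z0 (i, j, l)).
apply: contraction_eq0 => N IH [[{}i {}j] {}l]; rewrite /z /=.
apply: (@fil_euS_inv _ _ char0 2) => //.
have /(congr1 (fun U : 'rV_n => U 0 l)) := eu_curv i j.
rewrite mxE mulmxnE mxE => ->; rewrite !mxE; apply/filN/fil_sum => m _.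
rewrite -addn1; apply: filM; [exact: (IH (i, j, m)) | exact: fil_ad_gen_pt].
Qed.

Variable T : 'M[A]_n.
Hypothesis thT : th *m T = 1%:M.

Local Notation nab i := (vf (T i)).

Lemma map_vf p q (v : 'I_n -> A) (U : 'M[A]_(p, q)) :
  map_mx (vf v) U = \sum_i v i *: map_mx (pd i) U.
Proof.
apply/matrixP => a b; rewrite mxE summxE; apply: eq_bigr => i _.
by rewrite !mxE.
Qed.

(** As T is the inverse of [th], differentiating it turns zero curvature into the bracket of the
    dual frame, here paired with [th]. *)
Lemma nab_row_curv a b :
  (map_mx (nab a) (row b T) - map_mx (nab b) (row a T)) *m th =
  row b (ad_mx (delta_mx 0 a)).
Proof.
have Tth := mulmx1C thT.
have nabT e f : map_mx (nab e) (row f T) *m th =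
    - \sum_i \sum_j (T e i * T f j) *: map_mx (pd i) (row j th).
  rewrite map_row (der_inv (vfM (T e)) Tth) linearN /= mulNmx !row_mul -!mulmxA.
  rewrite Tth mulmx1; congr (- _); rewrite map_vf mulmx_sumr; apply: eq_bigr =>
    i _.
  rewrite -scalemxAr mulmx_sum_row scaler_sumr; apply: eq_bigr => j _.
  by rewrite scalerA mxE -map_row.
rewrite mulmxBl !nabT opprK addrC [X in X - _]exchange_big -sumrB.
transitivity (\sum_i \sum_j (T a i * T b j) *: (row j th *m ad_mx (row i th))).
  apply: eq_bigr => i _; rewrite -sumrB; apply: eq_bigr => j _ /=.
  rewrite [T b j * _]mulrC -scalerBr; congr (_ *: _).
  have /eqP := curv_eq0 i j; rewrite addr_eq0 -opprB eqr_opp => /eqP.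
  by move=> ->.
have eT e : delta_mx 0 e = \sum_i T e i *: row i th :> 'rV_n.
  by rewrite -row1 -Tth row_mul mulmx_sum_row; apply: eq_bigr => i _; rewrite mxE.
rewrite rowE (eT a) (eT b) linear_sum mulmx_sumr; apply: eq_bigr => i _ /=.
rewrite mulmx_suml; apply: eq_bigr => j _.
by rewrite linearZ /= -scalemxAr -scalemxAl scalerA.
Qed.

Lemma nab_curv a b j : nab a (T b j) - nab b (T a j) = \sum_l c a b l *: T l j.
Proof.
have /(congr1 (fun U => (U *m T) 0 j)) := nab_row_curv a b.
rewrite -mulmxA thT mulmx1 !mxE => ->; apply: eq_bigr => l _.
rewrite !mxE (bigD1 a) //= mxE !eqxx big1 ?addr0; last first.
  by move=> i ia; rewrite mxE (negPf ia) andbF scaler0.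
by rewrite -scalerAl mul1r.
Qed.

Lemma nabC a b f : nab a (nab b f) - nab b (nab a f) = \sum_l c a b l *: nab l f.
Proof.
rewrite vfC /vf; under eq_bigr => j _ do rewrite nab_curv mulr_suml.
rewrite exchange_big; apply: eq_bigr => l _; rewrite scaler_sumr.
by apply: eq_bigr => j _; rewrite scalerAl.
Qed.

Lemma fil_invT i j : fil 1 (T i j - (i == j)%:R).
Proof.
have -> : T i j - (i == j)%:R = - ((th - 1%:M) *m T) i j.
  by rewrite mulmxBl thT mul1mx !mxE opprB.
rewrite mxE; apply/filN/fil_sum => l _.
by apply: filMl (_ : fil 1 _) => //; rewrite !mxE; apply: th_fil.
Qed.

Variable a : 'M[k]_n.
Hypothesis a_der : forall i j l,
  \sum_m a m i * c m j l + \sum_m a m j * c i m l = \sum_m c i j m * a l m.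

Local Notation rho := (vf (lvf a)).
Local Notation aA := (map_mx (in_alg A) a^T).

Lemma mulmx_aA p (U : 'M[A]_(p, n)) i j : (U *m aA) i j = \sum_l a j l *: U i l.
Proof. by rewrite mxE; apply: eq_bigr => l _; rewrite !mxE -scalerAr mulr1. Qed.

Lemma aA_mulmx p (U : 'M[A]_(n, p)) i j : (aA *m U) i j = \sum_l a l i *: U l j.
Proof. by rewrite mxE; apply: eq_bigr => l _; rewrite !mxE -scalerAl mul1r. Qed.

Lemma rho_gen_pt : map_mx rho gen_pt = gen_pt *m aA.
Proof.
apply/rowP => j; rewrite mulmx_aA !mxE vf_X.
by apply: eq_bigr => l _; rewrite mxE.
Qed.

Lemma adm_aA u : ad_mx (u *m aA) = ad_mx u *m aA - aA *m ad_mx u.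
Proof.
apply/matrixP => j l; rewrite [RHS]mxE [X in _ + X]mxE mulmx_aA aA_mulmx mxE.
under eq_bigr => m _ do rewrite mulmx_aA scaler_sumr.
rewrite exchange_big; under [X in X - _]eq_bigr do rewrite mxE scaler_sumr.
under [X in _ - X]eq_bigr do rewrite mxE scaler_sumr.
rewrite [X in X - _]exchange_big [X in _ - X]exchange_big -sumrB.
apply: eq_bigr => i _ /=.
under eq_bigr do rewrite scalerA; under [X in X - _]eq_bigr do rewrite scalerA.
under [X in _ - X]eq_bigr do rewrite scalerA.
rewrite -!scaler_suml -scalerBl; congr (_ *: _).
apply: (canRL (addrK _)); under eq_bigr do rewrite mulrC.
by rewrite a_der; apply: eq_bigr => m _; rewrite mulrC.
Qed.

(** [a] is the matrix of a derivation of V, and [rho] moves the generic point by this derivation.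
    The defect Z then satisfies eu Z + Z = - Z ad X, the homogeneous form of the equation of [th],
    and vanishes by contraction. *)
Lemma rho_th : map_mx rho th = th *m aA - aA *m th.
Proof.
pose Z := map_mx rho th + aA *m th - th *m aA.
suff /eqP : Z = 0 by rewrite subr_eq0 => /eqP/(canRL (addrK _)).
have eu_aA : map_mx (@eu k n) aA = 0.
  apply/matrixP => i j; rewrite !mxE linearZ /=.
  by rewrite (der_nat (@euM k n) 1) scaler0.
have eu_rho : map_mx (@eu k n) (map_mx rho th) = map_mx rho (map_mx (@eu k n) th).
  by apply/matrixP => i j; rewrite !mxE eu_vf_lvf.
have euZ : map_mx (@eu k n) Z + Z = - (Z *m ad_mx gen_pt).
  have euth := canRL (addrK _) th_eu.
  rewrite /Z raddfB raddfD /= eu_rho !(der_mulmx (@euM k n)) eu_aA mul0mx mulmx0.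
  rewrite add0r addr0 euth !raddfB /= (der_scalar_mx (vfM (lvf a)) n 1) sub0r.
  rewrite (der_mulmx (vfM (lvf a))) der_ad_mx rho_gen_pt adm_aA.
  rewrite !(mulmxBl, mulmxBr, mulmxDl, mulmxDr, mulNmx, mulmxN) !mulmxA mulmx1
    mul1mx.
  move: (_ *m ad_mx gen_pt *m _) (map_mx rho th *m _) (th *m aA *m _) (aA *m th
    *m _).
  move: (map_mx rho th) (th *m aA) (aA *m th) => x1 x2 x3 x4 x5 x6 x7.
  by apply/matrixP => i j; rewrite !mxE; ring.
apply/matrixP => i j; rewrite [RHS]mxE.
pose z (x : 'I_n * 'I_n) := Z x.1 x.2.
have z0 : forall x, z x = 0; last exact: (z0 (i, j)).
apply: contraction_eq0 => N IH [{}i {}j]; rewrite /z /=.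
apply: (@fil_euS_inv _ _ char0 1) => //.
have /(congr1 (fun U : 'M_n => U i j)) := euZ.
rewrite mxE [X in X + _]mxE mulr1n => ->; rewrite !mxE; apply/filN/fil_sum => m _.
rewrite -addn1; apply: filM; [exact: (IH (i, m)) | exact: fil_ad_gen_pt].
Qed.

Lemma rho_nabC b f :
  rho (nab b f) - nab b (rho f) = - \sum_m a m b *: nab m f.
Proof.
have rhoT : map_mx rho T = T *m aA - aA *m T.
  have Tth := mulmx1C thT.
  rewrite (der_inv (vfM (lvf a)) Tth) rho_th mulmxBr mulmxBl opprB !mulmxA Tth
    mul1mx.
  by rewrite -[_ *m th *m T]mulmxA thT mulmx1.
have vfE (x : 'I_n -> A) (g : A) : vf x g = \sum_i x i * pd i g by [].
rewrite vfC {1}vfE -sumrN; under [RHS]eq_bigr do rewrite vfE scaler_sumr -sumrN.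
rewrite [RHS]exchange_big; apply: eq_bigr => j _ /=.
have -> : vf (lvf a) (T b j) = (T *m aA - aA *m T) b j by rewrite -rhoT mxE.
rewrite mxE [X in (_ + X - _) * _]mxE mulmx_aA aA_mulmx vf_lvf.
rewrite addrAC subrr add0r mulNr mulr_suml -sumrN.
by apply: eq_bigr => l _; rewrite -scalerAl.
Qed.

End MaurerCartan.

(** * Poisson bracket in an invariant frame *)

Section Frame.
Variables (k : fieldType) (n : nat).
Hypothesis char0 : [pchar k] =i pred0.
Local Notation A := (symhat k n).
Local Notation fil := (@symhat_filt k n).
Implicit Types f h : A.

Variables U W : 'M[A]_n.
Hypothesis UW : U *m W = 1%:M.
Local Notation par i := (vf (U i)).

Lemma pd_par j f : pd j f = \sum_l W j l * par l f.
Proof.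
transitivity (\sum_i (W *m U) j i * pd i f).
  rewrite (mulmx1C UW) (bigD1 j) //= mxE eqxx mul1r big1 ?addr0 // => i ij.
  by rewrite mxE eq_sym (negPf ij) mul0r.
under eq_bigr do rewrite mxE mulr_suml.
rewrite exchange_big; apply: eq_bigr => l _; rewrite mulr_sumr.
by apply: eq_bigr => i _; rewrite mulrA.
Qed.

Definition frame_coord (v : 'I_n -> A) (l : 'I_n) : A := \sum_j v j * W j l.

Lemma frame_coordP v f : vf v f = \sum_l frame_coord v l * par l f.
Proof.
under eq_bigr => l _ do rewrite mulr_suml.
rewrite exchange_big; apply: eq_bigr => j _; rewrite pd_par mulr_sumr.
by apply: eq_bigr => l _; rewrite mulrA.
Qed.

(** Lets coefficients be identified from identities between operators; the coordinate functions are
    enough as test functions. *)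
Lemma par_free (u : 'I_n -> A) :
  (forall f, \sum_l u l * par l f = 0) -> forall l, u l = 0.
Proof.
move=> u0 l; have u_eq0 : (\row_i u i) *m U = 0.
  apply/rowP => j; rewrite !mxE -[RHS](u0 (symhat_X k j)); apply: eq_bigr => i _.
  by rewrite mxE vf_X.
have /(congr1 (mulmx^~ W)) := u_eq0; rewrite -mulmxA UW mulmx1 mul0mx.
by move=> /(congr1 (fun v : 'rV_n => v 0 l)); rewrite !mxE.
Qed.

Lemma fil_par_inv N f : fil 1 f -> (forall i, fil N (par i f)) -> fil N.+1 f.
Proof.
move=> f1 fN; apply: (fil_eu_inv char0) => //; rewrite eu_euler.
apply: fil_sum => i _; rewrite -add1n; apply: filM; first exact: fil_X.
by rewrite pd_par; apply: fil_sum => l _; apply/filMr/fN.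
Qed.

Variables C D : 'I_n -> 'I_n -> 'I_n -> k.
Hypothesis C_anti : forall i j l, C i j l = - C j i l.
Hypothesis D_anti : forall i j l, D i j l = - D j i l.
Local Notation rho i := (vf (lvf (\matrix_(j, l) C i j l))).
(** When C and D are the structure constants of g and g^*, this and [rho_parC] say that sending e_i
    to [- rho i] and e^j to [par j] reverses the bracket of the double. *)
Hypothesis parC : forall i j f,
  par i (par j f) - par j (par i f) = - \sum_l D i j l *: par l f.
Hypothesis rho_parC : forall i j f,
  rho i (par j f) - par j (rho i f) =
  - \sum_l C i l j *: par l f - \sum_l D j l i *: rho l f.

(** The bivector pairs the invariant frame with the dressing fields. Skew-symmetry is not visible in
    this form. *)
Definition pl_bracket f h : A := \sum_i par i f * rho i h.

Lemma fil_rho i N f : fil N f -> fil N (rho i f).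
Proof. by rewrite -[N in fil N (rho i f)]add0n; apply/fil_vf1/fil_lvf. Qed.

Lemma fil_rho1 i f : fil 1 (rho i f).
Proof. by apply: fil_sum => j _; apply/filMl/fil_lvf. Qed.

Fact pl_bracket_linearl h : linear (pl_bracket^~ h).
Proof.
move=> c f g; rewrite /pl_bracket scaler_sumr -big_split; apply: eq_bigr => i _
  /=.
by rewrite linearP mulrDl scalerAl.
Qed.

Fact pl_bracket_linearr f : linear (pl_bracket f).
Proof.
move=> c h g; rewrite /pl_bracket scaler_sumr -big_split; apply: eq_bigr => i _
  /=.
by rewrite linearP mulrDr scalerAr.
Qed.

(* This is the infinitesimal multiplicativity of the Poisson bracket of G^*. *)
Lemma par_pl_bracket m f h :
  par m (pl_bracket f h) = pl_bracket (par m f) h + pl_bracket f (par m h)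
                   + \sum_i \sum_j C i j m *: (par i f * par j h).
Proof.
have parmi i : par m (par i f) = par i (par m f) - \sum_l D m i l *: par l f.
  by rewrite -parC addrC subrK.
have parmr i : par m (rho i h) = rho i (par m h) + \sum_l C i l m *: par l h
    + \sum_l D m l i *: rho l h.
  by have /eqP := rho_parC i m h; rewrite subr_eq => /eqP ->; ring.
transitivity (\sum_i (par i (par m f) * rho i h + par i f * rho i (par m h)
      + \sum_l C i l m *: (par i f * par l h))
    + (\sum_i \sum_l D m l i *: (par i f * rho l h)
      - \sum_i \sum_l D m i l *: (par l f * rho i h))).
  rewrite raddf_sum -sumrB -big_split; apply: eq_bigr => i _ /=.
  have suml (d : 'I_n -> k) (u : 'I_n -> A) (v : A) :
      (\sum_l d l *: u l) * v = \sum_l d l *: (u l * v).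
    by rewrite mulr_suml; apply: eq_bigr => l _; rewrite scalerAl.
  have sumr (d : 'I_n -> k) (u : 'I_n -> A) (v : A) :
      v * (\sum_l d l *: u l) = \sum_l d l *: (v * u l).
    by rewrite mulr_sumr; apply: eq_bigr => l _; rewrite scalerAr.
  by rewrite vfM parmi parmr -!sumr -!suml; ring.
rewrite [X in _ + (X - _)]exchange_big subrr addr0.
by rewrite !big_split.
Qed.

(** The symmetric part z obeys par m z(f, h) = z(par m f, h) + z(f, par m h), the C-terms
    cancelling, and vanishes at the origin because [rho] does. Hence z gains a degree, for all pairs
    (f, h) at once. *)
Lemma pl_bracket_anti f h : pl_bracket f h = - pl_bracket h f.
Proof.
apply/eqP; rewrite -addr_eq0; apply/eqP.
pose z (x : A * A) := pl_bracket x.1 x.2 + pl_bracket x.2 x.1.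
have z0 : forall x, z x = 0; last exact: (z0 (f, h)).
apply: contraction_eq0 => N IH [{}f {}h]; rewrite /z /=.
have PA_fil1 f' h' : fil 1 (pl_bracket f' h').
  by apply: fil_sum => i _; apply/filMr/fil_rho1.
apply: fil_par_inv => [|m]; first exact: filD.
rewrite raddfD /= !par_pl_bracket; have := filD (IH (par m f, h)) (IH (f, par m
  h)).
rewrite /z /=; congr fil.
rewrite [X in _ = _ + (_ + X)](_ : _ =
  - \sum_i \sum_j C i j m *: (par i f * par j h)); first by ring.
rewrite exchange_big -sumrN; apply: eq_bigr => i _; rewrite -sumrN.
by apply: eq_bigr => j _; rewrite C_anti scaleNr mulrC.
Qed.

(** The Poisson bivector read in the frame; as a function of its two indices, a 2-cochain of g with
    values in series. *)
Definition pl_coef i : 'I_n -> A := frame_coord (lvf (\matrix_(j, l) C i j l)).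

Lemma rhoE i f : rho i f = \sum_j pl_coef i j * par j f.
Proof. exact: frame_coordP. Qed.

Lemma pl_coef_anti i j : pl_coef i j = - pl_coef j i.
Proof.
apply/eqP; rewrite -addr_eq0; apply/eqP; move: j; apply: par_free => h.
move: i; apply: par_free => f.
have := pl_bracket_anti f h; move/eqP; rewrite -addr_eq0 => /eqP PA0.
rewrite -[RHS]PA0 /pl_bracket; under [X in _ = X + _]eq_bigr do rewrite rhoE
  mulr_sumr.
under [X in _ = _ + X]eq_bigr do rewrite rhoE mulr_sumr.
rewrite [X in _ = _ + X]exchange_big -big_split; apply: eq_bigr => i _ /=.
rewrite -big_split mulr_suml; apply: eq_bigr => j _ /=.
by ring.
Qed.

Definition eu_coef : 'I_n -> A := frame_coord (@symhat_X k n).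

Lemma eu_par f : eu f = \sum_i eu_coef i * par i f.
Proof. by rewrite eu_euler -[LHS]/(vf _ f) frame_coordP. Qed.

Lemma fil_eu_coef i : fil 1 (eu_coef i).
Proof. by apply: fil_sum => j _; apply/filMl/fil_X. Qed.

(** This is the vanishing of the commutator of [rho x] and [eu], with [eu] expanded in the frame. *)
Lemma rho_eu_coef x y :
  rho x (eu_coef y) = \sum_i C x y i *: eu_coef i + \sum_i \sum_l D i l x *:
    (eu_coef i * pl_coef l y).
Proof.
apply/eqP; rewrite -subr_eq0; apply/eqP; move: y; apply: par_free => f.
have := eu_vf_lvf (\matrix_(j, l) C x j l) f; rewrite !eu_par raddf_sum /= =>
  /eqP.
rewrite eq_sym -subr_eq0 -sumrB => /eqP E; rewrite -[RHS]E.
under [RHS]eq_bigr => i _ do rewrite vfM -addrA -mulrBr rho_parC.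
rewrite [RHS]big_split /=; under eq_bigr => y _ do rewrite mulrBl.
rewrite sumrB; congr (_ + _); under [RHS]eq_bigr => i _ do rewrite mulrBr mulrN.
rewrite big_split sumrN /= sumrN -opprD; congr (- _).
under eq_bigr => y _ do rewrite mulrDl; rewrite big_split /=; congr (_ + _).
  under eq_bigr do rewrite mulr_suml; rewrite exchange_big; apply: eq_bigr => i _.
  by rewrite mulr_sumr; apply: eq_bigr => l _; rewrite -scalerAl -scalerAr.
under eq_bigr do rewrite mulr_suml; rewrite exchange_big; apply: eq_bigr => i _.
under eq_bigr do rewrite mulr_suml; rewrite exchange_big mulr_sumr; apply:
  eq_bigr => l _.
rewrite rhoE scaler_sumr mulr_sumr; apply: eq_bigr => j _.
by rewrite -scalerAl -scalerAr mulrA.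
Qed.

(** Expanding the same commutator with [rho x] written in the frame gives [eu (pl_coef x y)] up to a
    D-term. [rho_eu_coef] with x and y exchanged removes that term, thanks to the skew-symmetry of
    [pl_coef]. *)
Lemma eu_pl_coef x y :
  eu (pl_coef x y) = rho x (eu_coef y) - rho y (eu_coef x) - \sum_i C x y i *:
    eu_coef i.
Proof.
have -> : eu (pl_coef x y) = rho x (eu_coef y) + \sum_i \sum_j D i j y *:
  (eu_coef i * pl_coef x j).
  apply/eqP; rewrite -subr_eq0; apply/eqP; move: y; apply: par_free => f.
  have := eu_vf_lvf (\matrix_(j, l) C x j l) f; rewrite !rhoE raddf_sum /= =>
    /eqP.
  rewrite -subr_eq0 -sumrB => /eqP E; rewrite -[RHS]E.
  have comm j : eu (par j f) - par j (eu f) =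
      - (\sum_i (\sum_l D i j l *: (eu_coef i * par l f) + par j (eu_coef i) *
        par i f)).
    rewrite !eu_par [vf (U j) (\sum_i _)]raddf_sum -[RHS]sumrN /=.
    rewrite -sumrB; apply: eq_bigr => i _ /=.
    have -> : par i (par j f) = par j (par i f) - \sum_l D i j l *: par l f.
      by rewrite -parC addrC subrK.
    rewrite vfM; under [X in _ = - (X + _)]eq_bigr do rewrite scalerAr.
    by rewrite -mulr_sumr; ring.
  transitivity (\sum_i (eu (pl_coef x i) * par i f
                        + pl_coef x i * (eu (par i f) - par i (eu f)))); last
                          first.
    by apply: eq_bigr => i _; rewrite euM mulrBr addrA.
  under eq_bigr do rewrite mulrBl.
  rewrite sumrB [RHS]big_split /=; congr (_ + _).
  under [RHS]eq_bigr do rewrite comm mulrN.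
  rewrite sumrN; congr (- _); under eq_bigr do rewrite mulrDl.
  under [RHS]eq_bigr do rewrite big_split mulrDr /=.
  rewrite !big_split /= addrC; congr (_ + _).
    under eq_bigr => l _ do rewrite mulr_suml.
    under [RHS]eq_bigr => j _ do rewrite mulr_sumr.
    rewrite exchange_big [RHS]exchange_big; apply: eq_bigr => i _ /=.
    under eq_bigr => l _ do rewrite mulr_suml.
    under [RHS]eq_bigr => j _ do rewrite mulr_sumr.
    rewrite exchange_big; apply: eq_bigr => j _; apply: eq_bigr => l _ /=.
    by rewrite -scalerAl -scalerAr mulrCA mulrA.
  under eq_bigr => l _ do rewrite rhoE mulr_suml.
  under [RHS]eq_bigr => j _ do rewrite mulr_sumr.
  rewrite exchange_big; apply: eq_bigr => j _; apply: eq_bigr => l _ /=.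
  by rewrite mulrA.
rewrite (rho_eu_coef y x) opprD addrA -addrA -[RHS]addrA; congr (_ + _).
under [X in _ = _ - X]eq_bigr do rewrite C_anti scaleNr.
rewrite sumrN opprK addrAC addNr add0r -sumrN; apply: eq_bigr => i _.
rewrite -sumrN; apply: eq_bigr => j _.
by rewrite pl_coef_anti D_anti mulrN scalerN scaleNr opprK.
Qed.

Definition EE_coef i : A := ieu 0 (eu_coef i).

Lemma eu_EE_coef i : eu (EE_coef i) = eu_coef i.
Proof. by apply: eu_ieu0 => //; apply: fil_eu_coef. Qed.

Lemma fil_EE_coef i : fil 1 (EE_coef i).
Proof. exact/fil_ieu/fil_eu_coef. Qed.

(* As eu commutes with rho, dividing by the degree turns eu_pl_coef into the
   statement that pl_coef is the coboundary of the cochain EE_coef of g. *)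
Lemma EE_coef_coboundary x y :
  rho x (EE_coef y) - rho y (EE_coef x) - \sum_i C x y i *: EE_coef i = pl_coef
    x y.
Proof.
apply/eqP; rewrite -subr_eq0; apply/eqP; set Y := _ - _.
have Y1 : fil 1 Y.
  apply: filB; last by apply: fil_sum => j _; apply/filMl/fil_lvf.
  apply: filB; first by apply: filB; apply: fil_rho1.
  by apply: fil_sum => i _; apply/filZ/fil_EE_coef.
rewrite -(ieu0K char0 Y1) (_ : eu Y = 0) ?raddf0 //.
have euC : eu (\sum_i C x y i *: EE_coef i) = \sum_i C x y i *: eu_coef i.
  by rewrite raddf_sum; apply: eq_bigr => i _; rewrite /= linearZ /= eu_EE_coef.
by rewrite /Y !raddfB /= !eu_vf_lvf !eu_EE_coef euC eu_pl_coef subrr.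
Qed.

Definition EE : {linear A -> A} := vf (fun j => \sum_i EE_coef i * U i j).

Lemma EE_par f : EE f = \sum_i EE_coef i * par i f.
Proof.
transitivity (\sum_j (\sum_i EE_coef i * U i j) * pd j f); first by [].
under eq_bigr do rewrite mulr_suml.
rewrite exchange_big; apply: eq_bigr => i _; rewrite mulr_sumr.
by apply: eq_bigr => j _; rewrite mulrA.
Qed.

(** [eu_coef] starts in degree 1, where [ieu 0] is the identity. The coefficients of E - eu
    therefore start in degree 2, and such a field raises degrees by one. *)
Lemma fil_EE N f : fil N f -> fil N.+1 (EE f - eu f).
Proof.
move=> fN; have -> : EE f - eu f = vf (fun j => \sum_i (EE_coef i - eu_coef i) *
  U i j) f.
  rewrite EE_par eu_par -sumrB.
  transitivity (\sum_j (\sum_i (EE_coef i - eu_coef i) * U i j) * pd j f); last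
    by [].
  under [RHS]eq_bigr do rewrite mulr_suml.
  rewrite [RHS]exchange_big; apply: eq_bigr => i _ /=; rewrite -mulrBl mulr_sumr.
  by apply: eq_bigr => j _; rewrite mulrA.
rewrite -add1n; apply: fil_vf1 => // j; apply: fil_sum => i _.
apply: (@filMl k n 2 2) => // -[|[|d]] // _.
  by rewrite symhatBE fil_EE_coef // fil_eu_coef // subr0.
by rewrite symhatBE ieuE invr1 scale1r subrr.
Qed.

(** Expand E in the frame and apply [par_pl_bracket]. Beyond the Leibniz terms there remain the
    derivatives of [EE_coef] along [rho] and the C-term; for each pair of frame fields they form the
    coboundary of [EE_coef], which is the bivector itself. *)
Lemma EE_pl_bracket f h : EE (pl_bracket f h) = pl_bracket (EE f) h + pl_bracket
  f (EE h) - pl_bracket f h.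
Proof.
have PAl (u v : 'I_n -> A) g : pl_bracket (\sum_m u m * v m) g =
    \sum_m u m * pl_bracket (v m) g + \sum_m pl_bracket (u m) g * v m.
  rewrite /pl_bracket; under eq_bigr do rewrite raddf_sum mulr_suml.
  rewrite exchange_big -big_split; apply: eq_bigr => m _ /=.
  rewrite mulr_sumr mulr_suml -big_split; apply: eq_bigr => i _ /=.
  by rewrite vfM; ring.
have PAr g : pl_bracket f (EE g) = \sum_m EE_coef m * pl_bracket f (par m g)
    + \sum_i \sum_j par i f * par j g * rho i (EE_coef j).
  rewrite EE_par pl_bracket_anti PAl opprD -!sumrN; congr (_ + _).
    by apply: eq_bigr => m _; rewrite -mulrN -pl_bracket_anti.
  rewrite [RHS]exchange_big; apply: eq_bigr => m _ /=; rewrite -mulNr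
    -pl_bracket_anti.
  by rewrite /pl_bracket mulr_suml; apply: eq_bigr => i _; rewrite mulrAC.
rewrite PAr [EE f]EE_par PAl EE_par.
under eq_bigr do rewrite par_pl_bracket !mulrDr.
rewrite !big_split /=.
have -> : \sum_m pl_bracket (EE_coef m) h * par m f =
    - \sum_i \sum_j par i f * par j h * rho j (EE_coef i).
  rewrite -sumrN; apply: eq_bigr => i _; rewrite pl_bracket_anti mulNr
    /pl_bracket mulr_suml.
  by congr (- _); apply: eq_bigr => j _; rewrite mulrC mulrA.
have -> : \sum_m EE_coef m * (\sum_i \sum_j C i j m *: (par i f * par j h)) =
    \sum_i \sum_j par i f * par j h * (\sum_m C i j m *: EE_coef m).
  under eq_bigr => m _ do rewrite mulr_sumr; rewrite exchange_big.
  apply: eq_bigr => i _; under eq_bigr => m _ do rewrite mulr_sumr.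
  rewrite exchange_big; apply: eq_bigr => j _; rewrite [RHS]mulr_sumr.
  by apply: eq_bigr => m _; rewrite -!scalerAr mulrC.
have -> : pl_bracket f h = \sum_i \sum_j par i f * par j h * pl_coef i j.
  apply: eq_bigr => i _; rewrite rhoE mulr_sumr.
  by apply: eq_bigr => j _; rewrite mulrAC mulrA.
rewrite [X in _ + X = _](_ : _ =
   \sum_i \sum_j par i f * par j h * rho i (EE_coef j)
   - \sum_i \sum_j par i f * par j h * rho j (EE_coef i)
   - \sum_i \sum_j par i f * par j h * pl_coef i j); first by ring.
rewrite -!sumrB; apply: eq_bigr => i _; rewrite -!sumrB; apply: eq_bigr => j _.
by rewrite -EE_coef_coboundary; ring.
Qed.

End Frame.

(** * Euler-like vector fields *)

Section EulerLike.
Variables (k : fieldType) (n : nat).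
Hypothesis char0 : [pchar k] =i pred0.
Local Notation A := (symhat k n).
Local Notation fil := (@symhat_filt k n).
Implicit Types f g h x : A.

Fact homog_comp_subproof d f : (fun D => if D == d then f D else 0) \in
  @homog_seq k n.
Proof.
apply/homog_seqP => D; case: ifP => _; last exact: rpred0.
exact: symhat_homog.
Qed.

Definition homog_comp d f : A := SymHat (homog_comp_subproof d f).

Lemma homog_compE d f D : homog_comp d f D = if D == d then f D else 0. Proof.
  by []. Qed.

Fact homog_comp_linear d : linear (homog_comp d).
Proof.
move=> c f g; apply: symhat_eq => D; rewrite homog_compE !symhatDE !symhatZE
  !homog_compE.
by case: ifP; rewrite // scaler0 addr0.
Qed.
HB.instance Definition _ d := GRing.isLinear.Build k A A _ (homog_comp d)
  (homog_comp_linear d).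

Lemma eu_homog_comp d f : eu (homog_comp d f) = homog_comp d f *+ d.
Proof.
apply: symhat_eq => D; rewrite -scaler_nat symhatZE euE homog_compE.
by case: eqP => [->|]; rewrite ?scaler0.
Qed.

Lemma fil_homog_comp d f : fil d (homog_comp d f).
Proof. by move=> D Dd; rewrite homog_compE (ltn_eqF Dd). Qed.

Lemma fil_trunc N f : fil N (f - \sum_(d < N) homog_comp d f).
Proof.
move=> D DN; rewrite symhatBE (big_morph (fun h : A => h D) (fun f g => symhatDE
  f g D) (symhat0E k n D)).
rewrite (bigD1 (Ordinal DN)) //= eqxx big1 ?addr0 ?subrr // => i iD.
case: eqP => // E; case/negP: iD; apply/eqP/val_inj.
by rewrite /= E.
Qed.

Lemma homog_degree d g : eu g = g *+ d -> forall D, D != d -> g D = 0.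
Proof.
move=> gd D Dd; have /(congr1 (fun f : A => f D)) := gd.
rewrite euE -scaler_nat symhatZE => /eqP; rewrite -subr_eq0 -scalerBl scaler_eq0.
by rewrite subr_eq0 natf_eq // (negPf Dd) => /eqP.
Qed.

Lemma homog_fil d f : eu f = f *+ d -> fil d f.
Proof. by move=> fd D Dd; apply: (homog_degree fd); rewrite ltn_eqF. Qed.

(** A series is an infinite sum of its components, which bilinearity alone cannot reach;
    compatibility with the filtration allows both arguments to be truncated. *)
Lemma homog_bilinear_eq0 (B : A -> A -> A) :
  (forall h, additive (B^~ h)) -> (forall f, additive (B f)) ->
  (forall M N f h, fil M f -> fil N h -> fil (M + N) (B f h)) ->
  (forall d e f h, eu f = f *+ d -> eu h = h *+ e -> B f h = 0) ->
  forall f h, B f h = 0.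
Proof.
move=> Bl Br Bfil B0 f h; apply: fil_eq0 => N.
pose Blm h := GRing.isZmodMorphism.Build _ _ (B^~ h) (Bl h).
pose Brm f := GRing.isZmodMorphism.Build _ _ (B f) (Br f).
pose Bla h : {additive A -> A} := HB.pack (B^~ h) (Blm h).
pose Bra f : {additive A -> A} := HB.pack (B f) (Brm f).
have BlB h' f1 f2 : B (f1 - f2) h' = B f1 h' - B f2 h' by apply: (raddfB (Bla
  h')).
have BrB f' h1 h2 : B f' (h1 - h2) = B f' h1 - B f' h2 by apply: (raddfB (Bra
  f')).
have Bls h' (F : 'I_N -> A) : B (\sum_i F i) h' = \sum_i B (F i) h'.
  exact: (raddf_sum (Bla h')).
have Brs f' (F : 'I_N -> A) : B f' (\sum_i F i) = \sum_i B f' (F i).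
  exact: (raddf_sum (Bra f')).
have tr0 : B (\sum_(d < N) homog_comp d f) (\sum_(d < N) homog_comp d h) = 0.
  rewrite Bls big1 // => d _; rewrite Brs big1 // => e _.
  by apply: (B0 d e); apply: eu_homog_comp.
rewrite -[B f h]subr0 -tr0.
rewrite -[X in fil _ X](subrKA (B (\sum_(d < N) homog_comp d f) h)) -BlB -BrB.
apply: filD; last by rewrite -[X in fil X _]add0n; apply: Bfil; [|apply:
  fil_trunc].
by rewrite -[X in fil X _]addn0; apply: Bfil; [apply: fil_trunc|].
Qed.

Variable EE : {linear A -> A}.
Hypothesis fil_EE : forall N f, fil N f -> fil N.+1 (EE f - eu f).

Let Ep f := EE f - eu f.

Let EpB f g : Ep (f - g) = Ep f - Ep g.
Proof. by rewrite /Ep !raddfB /=; ring. Qed.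

(** E multiplies a lowest component of degree D by D, and D >= N excludes the eigenvalue d - s. The
    shift s avoids truncated subtraction when that eigenvalue is negative. *)
Lemma eigen_eq0 s d N x :
  (d < N + s)%N -> fil N x -> EE x + x *+ s = x *+ d -> x = 0.
Proof.
move=> dNs xN xE; apply: fil_eq0 => M; apply: (@fil_le _ _ _ (N + M)); first
  exact: leq_addl.
elim: M => [|M IH]; first by rewrite addn0.
rewrite addnS => D; rewrite ltnS leq_eqVlt => /orP[/eqP ->|]; last exact: IH.
have := fil_EE IH (ltnSn _); rewrite (_ : EE x - eu x = x *+ d - x *+ s - eu x);
  last first.
  by rewrite -xE addrK.
rewrite !symhatBE -!scaler_nat !symhatZE euE -!scalerBl => /eqP.
rewrite scaler_eq0 => /orP[|/eqP //].
rewrite -addrA -opprD -natrD subr_eq0 natf_eq // => /eqP E.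
by move: dNs; rewrite E; lia.
Qed.

Let inv_d_subproof d f :
  (fun D => if (d < D)%N then ((D - d)%:R)^-1 *: f D else 0) \in @homog_seq k n.
Proof.
apply/homog_seqP => D; case: ifP => _; last exact: rpred0.
by rewrite rpredZ ?symhat_homog.
Qed.

(** The equation is (eu - d) (x - g) = - (E - eu) x. The right side starts above degree d, where eu
    - d is inverted by [inv], and x is a fixed point because E - eu gains a degree. *)
Lemma eigen_exists d g : eu g = g *+ d ->
  exists x, EE x = x *+ d /\ fil d.+1 (x - g).
Proof.
move=> gd; pose inv f : A := SymHat (inv_d_subproof d f).
have invE f D : inv f D = if (d < D)%N then ((D - d)%:R)^-1 *: f D else 0 by [].
have [|u uE] := @contraction_fix k n unit (fun u t => g - inv (Ep (u t))).
  move=> N u v uvN [].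
  have -> : g - inv (Ep (u tt)) - (g - inv (Ep (v tt))) = inv (Ep (v tt - u tt)).
    rewrite EpB; move: (Ep (u tt)) (Ep (v tt)) => y z.
    apply: symhat_eq => D; rewrite !symhatBE !invE; case: ifP => _; last by ring.
    by rewrite symhatBE scalerBr; ring.
  have := fil_EE (filN (uvN tt)); rewrite opprB => EuN D DN.
  by rewrite invE /Ep EuN // scaler0; case: ifP.
exists (u tt); set x := u tt; have xE : x = g - inv (Ep x) by rewrite uE.
have gD := homog_degree gd.
have xg : fil d.+1 (x - g).
  move=> D; rewrite ltnS leqNgt => /negPf Dd.
  by rewrite xE addrAC subrr add0r symhatNE invE Dd oppr0.
split=> //; have xfil : fil d x.
  rewrite -[x](subrK g); apply: filD => [|D Dd]; first exact: fil_le xg.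
  by rewrite gD // neq_ltn Dd.
apply: symhat_eq => D; rewrite -scaler_nat symhatZE.
have EpD : (EE x - eu x) D = EE x D - D%:R *: x D by rewrite symhatBE euE.
have [dD|Dd] := ltnP d D; last first.
  have /eqP := fil_EE xfil Dd; rewrite EpD subr_eq0 => /eqP ->.
  have [->//|nDd] := eqVneq D d; rewrite xfil ?scaler0 //.
  by rewrite ltn_neqAle nDd.
have xD : (D%:R - d%:R) *: x D = - (EE x - eu x) D.
  rewrite {1}xE symhatBE invE dD gD ?gtn_eqF // sub0r scalerN scalerA -natrB
    1?ltnW //.
  by rewrite mulfV ?scale1r // natf_eq0 // subn_eq0 leqNgt dD.
by move: xD; rewrite EpD opprB scalerBl => /addrI/oppr_inj.
Qed.

(* kap f is the sum of the eigenvectors of EE whose leading terms are the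
   homogeneous components of f. *)
Lemma eigen_section : exists kap : {linear A -> A},
  (forall f, EE (kap f) = kap (eu f)) /\
  (forall N f, fil N f -> fil N.+1 (kap f - f)).
Proof.
have /choice[q qP] (x : nat * A) : exists y, EE y = y *+ x.1 /\
    fil x.1.+1 (y - homog_comp x.1 x.2).
  by apply: eigen_exists; apply: eu_homog_comp.
have qE d f : EE (q (d, f)) = q (d, f) *+ d by case: (qP (d, f)).
have qfil d f : fil d.+1 (q (d, f) - homog_comp d f) by case: (qP (d, f)).
(* The choice of eigenvectors is arbitrary, but an eigenvector of eigenvalue d is determined by its
   leading term, and this forces linearity. *)
have q_lin d c f g : q (d, c *: f + g) = c *: q (d, f) + q (d, g).
  apply/eqP; rewrite -subr_eq0; apply/eqP.
  apply: (@eigen_eq0 0 d d.+1); first by rewrite addn0.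
    rewrite -[X in fil _ X](subrKA (homog_comp d (c *: f + g))); apply: filD =>
      //.
    rewrite linearP /= opprD addrACA -scalerBr; apply: filD.
      by apply: filZ; rewrite -opprB; apply: filN.
    by rewrite -opprB; apply: filN.
  have E2 : EE (c *: q (d, f) + q (d, g)) = (c *: q (d, f) + q (d, g)) *+ d.
    by rewrite linearP /= !qE mulrnDl scalerMnr.
  by rewrite mulr0n addr0 [EE _]raddfB /= E2 qE mulrnBl.
have q_unique d f x : EE x = x *+ d -> fil d.+1 (x - homog_comp d f) -> q (d, f)
  = x.
  move=> xE xf; apply/eqP; rewrite -subr_eq0; apply/eqP.
  apply: (@eigen_eq0 0 d d.+1); first by rewrite addn0.
    rewrite -[X in fil _ X](subrKA (homog_comp d f)); apply: filD => //.
    by rewrite -opprB; apply: filN.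
  by rewrite mulr0n addr0 [EE _]raddfB /= qE xE mulrnBl.
(* As [q (d, f)] starts in degree d, only the indices d <= D contribute to degree D. *)
have kap_homog f : (fun D => \sum_(d < D.+1) q (d : nat, f) D) \in @homog_seq k n.
  by apply/homog_seqP => D; apply: rpred_sum => d _; apply: symhat_homog.
pose kp f : A := SymHat (kap_homog f).
have kp_lin : linear kp.
  move=> c f g; apply: symhat_eq => D; rewrite symhatDE symhatZE /= scaler_sumr
    -big_split.
  by apply: eq_bigr => d _; rewrite q_lin symhatDE symhatZE.
have qfil0 d f : fil d (q (d, f)).
  rewrite -[q _](subrK (homog_comp d f)); apply: filD; last exact: fil_homog_comp.
  exact: fil_le (qfil _ _).
have kp_trunc N f : fil N (kp f - \sum_(d < N) q (d : nat, f)).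
  move=> D DN; rewrite symhatBE (big_morph (fun h : A => h D) (fun f g =>
    symhatDE f g D) (symhat0E k n D)).
  rewrite -[kp f D]/(\sum_(d < D.+1) q (d : nat, f) D).
  rewrite (big_ord_widen N (fun d => q (d, f) D)) //.
  rewrite [X in _ - X](bigID (fun d : 'I_N => (d < D.+1)%N)) /=.
  rewrite opprD addrA subrr sub0r big1 ?oppr0 // => d; rewrite -leqNgt => Dd.
  exact: qfil0.
pose kap : {linear A -> A} := HB.pack kp (GRing.isLinear.Build k A A _ kp kp_lin).
exists kap; split=> [f|N f fN].
  apply/eqP; rewrite -subr_eq0; apply/eqP/fil_eq0 => N.
  have -> : EE (kap f) - kap (eu f) = EE (kp f - \sum_(d < N) q (d : nat, f))
      - (kp (eu f) - \sum_(d < N) q (d : nat, eu f)).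
    have -> : EE (kp f - \sum_(d < N) q (d : nat, f)) =
        EE (kap f) - \sum_(d < N) q (d : nat, eu f).
      rewrite [LHS]raddfB raddf_sum; congr (_ - _); apply: eq_bigr => d _ /=.
      rewrite qE; apply/esym/q_unique; first by rewrite raddfMn /= qE.
      rewrite [homog_comp _ (eu f)](_ : _ = homog_comp d f *+ d); last first.
        rewrite -eu_homog_comp; apply: symhat_eq => D; rewrite euE !homog_compE
          euE.
        by case: ifP; rewrite ?scaler0.
      by rewrite -mulrnBl -scaler_nat; apply: filZ.
    by rewrite opprB addrA subrK.
  apply: filB; last exact: kp_trunc.
  have fN := kp_trunc N f; rewrite -[X in fil _ X](subrK (eu (kp f - \sum_(d <
    N) q (d : nat, f)))).
  by apply: filD; [apply: fil_le (fil_EE fN) | apply: fil_eu].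
move=> D; rewrite ltnS leq_eqVlt symhatBE -[kap f D]/(\sum_(d < D.+1) q (d :
  nat, f) D).
have kfN d : (d < N)%N -> q (d, f) = 0.
  move=> dN; apply: q_unique; first by rewrite raddf0 mul0rn.
  rewrite (_ : homog_comp d f = 0) ?subr0 //; apply: symhat_eq => e; rewrite
    homog_compE.
  by case: eqP => // ->; apply: fN.
move=> /orP[/eqP ->|DN].
  rewrite big_ord_recr /= big1 ?add0r => [|d _]; last by rewrite kfN.
  by have := qfil N f _ (ltnSn N); rewrite symhatBE homog_compE eqxx.
rewrite big1 ?fN ?subrr // => d _; rewrite kfN //.
by apply: leq_trans DN; apply: ltn_ord.
Qed.

(** kap is the identity plus a map that gains a degree, so its inverse at f is the fixed point of y
    = f - (kap y - y). *)
Lemma kap_inverse (kap : {linear A -> A}) :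
  (forall N f, fil N f -> fil N.+1 (kap f - f)) ->
  exists2 u : A -> A, cancel u kap & cancel kap u /\
    forall N f, fil N f -> fil N (u f).
Proof.
move=> kapN; have kap_fil N f : fil N (kap f) -> fil N f.
  elim: N => [//|N IH] fN; rewrite -[f](subKr (kap f)); apply: filB => //.
  by apply: kapN; apply/IH/fil_le/fN.
have [|u uE] := @contraction_fix k n A (fun u f => f - (kap (u f) - u f)).
  move=> N u v uvN f.
  rewrite [X in fil _ X](_ : _ = - (kap (u f - v f) - (u f - v f))).
    exact/filN/kapN.
  by rewrite [kap (_ - _)]raddfB /=; ring.
have kapuK : cancel u kap.
  by move=> f; have /eqP := uE f; rewrite subr_eq addrC subrK => /eqP <-.
exists u => //; split=> [f|N f fN]; last by apply: kap_fil; rewrite kapuK.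
apply/eqP; rewrite -subr_eq0; apply/eqP/fil_eq0 => N; apply: kap_fil.
by rewrite raddfB /= kapuK subrr.
Qed.

Variable kap : {linear A -> A}.
Hypothesis EE_kap : forall f, EE (kap f) = kap (eu f).
Hypothesis fil_kapB : forall N f, fil N f -> fil N.+1 (kap f - f).

Lemma fil_kap N f : fil N f -> fil N (kap f).
Proof.
move=> fN; rewrite -[kap f](subrK f); apply: (filD _ fN).
exact: fil_le (fil_kapB fN).
Qed.

Hypothesis EEM : forall f h, EE (f * h) = EE f * h + f * EE h.

Lemma kap1 : kap 1 = 1.
Proof.
apply/eqP; rewrite -subr_eq0; apply/eqP.
apply: (@eigen_eq0 0 0 1) => //; first exact/fil_kapB/fil0.
rewrite !mulr0n addr0 raddfB /= EE_kap (der_nat EEM 1).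
by rewrite (der_nat (@euM k n) 1) raddf0 subr0.
Qed.

(** For homogeneous f and h the defect is an eigenvector of eigenvalue d + e, since E is a
    derivation, but it starts above degree d + e; [eigen_eq0] kills it. *)
Lemma kapM f h : kap (f * h) = kap f * kap h.
Proof.
apply/eqP; rewrite -subr_eq0; apply/eqP.
apply: (@homog_bilinear_eq0 (fun f h => kap (f * h) - kap f * kap h)).
- by move=> {}h f1 f2; rewrite mulrBl !raddfB /= mulrBl; ring.
- by move=> {}f h1 h2; rewrite mulrBr !raddfB /= mulrBr; ring.
- move=> M N {}f {}h fM hN; apply: filB; first exact/fil_kap/filM.
  by apply: filM; apply: fil_kap.
move=> d e {}f {}h fd he; have ff := homog_fil fd; have hf := homog_fil he.
apply: (@eigen_eq0 0 (d + e) (d + e).+1); first by rewrite addn0.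
  rewrite (_ : _ - _ = kap (f * h) - f * h
     - ((kap f - f) * kap h + f * (kap h - h))); last by ring.
  apply: filB; first exact/fil_kapB/filM.
  apply: filD; first by apply: (@filM _ _ d.+1); [apply: fil_kapB | apply:
    fil_kap].
  by rewrite -addnS; apply: filM => //; apply: fil_kapB.
rewrite mulr0n addr0 raddfB /= EEM !EE_kap euM fd he.
have kMn m g : kap (g *+ m) = kap g *+ m by exact: raddfMn.
by rewrite !kMn !mulrnAl !mulrnAr -!mulrnDr kMn mulrnBl.
Qed.

End EulerLike.

(** * Matching the linear bracket with the explicit Poisson-Lie bracket *)

Section Linearization.
Variables (k : fieldType) (n : nat).
Hypothesis char0 : [pchar k] =i pred0.
Local Notation A := (symhat k n).
Local Notation fil := (@symhat_filt k n).
Variables U W : 'M[A]_n.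
Hypothesis UW : U *m W = 1%:M.
Hypothesis U1 : forall i j, fil 1 (U i j - (i == j)%:R).
Local Notation par i := (vf (U i)).
Variables C D : 'I_n -> 'I_n -> 'I_n -> k.
Hypothesis C_anti : forall i j l, C i j l = - C j i l.
Hypothesis D_anti : forall i j l, D i j l = - D j i l.
Local Notation rho i := (vf (lvf (\matrix_(j, l) C i j l))).
Hypothesis parC : forall i j f,
  par i (par j f) - par j (par i f) = - \sum_l D i j l *: par l f.
Hypothesis rho_parC : forall i j f,
  rho i (par j f) - par j (rho i f) =
  - \sum_l C i l j *: par l f - \sum_l D j l i *: rho l f.

Definition kks_bracket (f h : A) : A := \sum_i pd i f * rho i h.

(** Both brackets have weight -1, one for eu and the other for E. On homogeneous arguments the
    defect is thus an eigenvector of E of eigenvalue d + e - 1, and it lies too deep in the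
    filtration to be nonzero. *)
Lemma linearization : exists kap : {linear A -> A},
  [/\ kap 1 = 1, forall f h, kap (f * h) = kap f * kap h,
      forall N f, fil N f -> fil N.+1 (kap f - f)
    & forall f h, kap (kks_bracket f h) = pl_bracket U C (kap f) (kap h)].
Proof.
pose E := EE U W.
have EfE := fil_EE UW : forall N f, fil N f -> fil N.+1 (E f - eu f).
have EM f h : E (f * h) = E f * h + f * E h by apply: vfM.
have EP := EE_pl_bracket char0 UW C_anti D_anti parC rho_parC.
have [kap [Ek kapN]] := eigen_section char0 EfE.
have kapf := fil_kap kapN.
exists kap; split=> [|f h||f h] //; [exact: (kap1 char0 EfE)|exact: (kapM char0
  EfE)|].
apply/eqP; rewrite -subr_eq0; apply/eqP; pose B f h := kap (kks_bracket f h) -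
  pl_bracket U C (kap f) (kap h).
have PAl u : linear (pl_bracket U C ^~ u) := pl_bracket_linearl U C u.
have PAr u : linear (pl_bracket U C u) := pl_bracket_linearr U C u.
have PABl u1 u2 u : pl_bracket U C (u1 - u2) u = pl_bracket U C u1 u -
  pl_bracket U C u2 u.
  by rewrite [u1 - u2]addrC -scaleN1r PAl scaleN1r addrC.
have PABr u1 u2 u : pl_bracket U C u (u1 - u2) = pl_bracket U C u u1 -
  pl_bracket U C u u2.
  by rewrite [u1 - u2]addrC -scaleN1r PAr scaleN1r addrC.
have PAMnl u1 u m : pl_bracket U C (u1 *+ m) u = pl_bracket U C u1 u *+ m.
  rewrite -!scaler_nat -[_ *: u1]addr0 PAl [pl_bracket U C 0 _](_ : _ = 0)
    ?addr0 //.
  by rewrite /pl_bracket big1 // => i _; rewrite raddf0 mul0r.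
have PAMnr u1 u m : pl_bracket U C u (u1 *+ m) = pl_bracket U C u u1 *+ m.
  rewrite -!scaler_nat -[_ *: u1]addr0 PAr [pl_bracket U C _ 0](_ : _ = 0)
    ?addr0 //.
  by rewrite /pl_bracket big1 // => i _; rewrite raddf0 mulr0.
have eu_kks f1 f2 : eu (kks_bracket f1 f2) = kks_bracket (eu f1) f2 +
  kks_bracket f1 (eu f2) - kks_bracket f1 f2.
  rewrite /kks_bracket raddf_sum -big_split -sumrB; apply: eq_bigr => i _ /=.
  by rewrite euM eu_pd eu_vf_lvf; ring.
have fil_par i N u : fil N u -> fil N (par i u - pd i u).
  move=> uN; rewrite (_ : _ - _ = vf (fun j => U i j - (i == j)%:R) u).
    exact: (@fil_vf1 _ _ 0 N).
  rewrite /vf; under [RHS]eq_bigr do rewrite mulrBl.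
  rewrite sumrB; congr (_ - _); rewrite (bigD1 i) //= eqxx mul1r big1 ?addr0 //
    => j ji.
  by rewrite eq_sym (negPf ji) mul0r.
have fil_PA M N u v : fil M.+1 u -> fil N v -> fil (M + N) (pl_bracket U C u v).
  by move=> uM vN; apply: fil_sum => i _; apply: filM; [apply: fil_vf|apply:
    fil_rho].
(* Each bracket may lose a degree, but they agree to leading order, as the frame is [pd] at the
   origin and [kap] is the identity to leading order. For M = 0 the factor in [rho] alone gives step
   N. *)
have fil_B M N u v : fil M u -> fil N v -> fil (M + N) (B u v).
  case: M => [|M] uM vN.
    apply: filB; last by apply: fil_sum => i _; apply: filMr (fil_rho _ _ (kapf
      _ _ vN)).
    by apply: kapf; apply: fil_sum => i _; apply: filMr (fil_rho _ _ vN).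
  rewrite (_ : B u v = (kap (kks_bracket u v) - kks_bracket u v) - (pl_bracket U
    C u v - kks_bracket u v)
      - pl_bracket U C (kap u - u) v - pl_bracket U C (kap u) (kap v - v)); last
        first.
    by rewrite PABl PABr /B; ring.
  apply: filB; last by rewrite addSnnS; apply: fil_PA; [apply: kapf|apply: kapN].
  apply: filB; last by apply: fil_PA => //; apply: kapN.
  apply: filB.
    apply: kapN; apply: fil_sum => i _; apply: filM; [exact: fil_pd|exact:
      fil_rho].
  rewrite -sumrB; apply: fil_sum => i _; rewrite -mulrBl.
  by apply: filM; [apply: fil_par|apply: fil_rho].
apply: (@homog_bilinear_eq0 k n B); rewrite /B.
- move=> {}h f1 f2; rewrite !raddfB /= PABl (_ : kks_bracket _ _ = kks_bracket
  f1 h - kks_bracket f2 h).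
    by rewrite raddfB /=; ring.
  by rewrite /kks_bracket -sumrB; apply: eq_bigr => i _; rewrite raddfB mulrBl.
- move=> {}f h1 h2; rewrite !raddfB /= PABr (_ : kks_bracket _ _ = kks_bracket f
  h1 - kks_bracket f h2).
    by rewrite raddfB /=; ring.
  by rewrite /kks_bracket -sumrB; apply: eq_bigr => i _; rewrite raddfB mulrBr.
- exact: fil_B.
move=> d e {}f {}h fd he.
apply: (@eigen_eq0 k n char0 E EfE 1 (d + e) (d + e)); first by rewrite addn1.
  by apply: fil_B; apply: (homog_fil char0).
have kksMnl m u v : kks_bracket (u *+ m) v = kks_bracket u v *+ m.
  by rewrite /kks_bracket -sumrMnl; apply: eq_bigr => i _; rewrite raddfMn
    mulrnAl.
have kksMnr m u v : kks_bracket u (v *+ m) = kks_bracket u v *+ m.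
  by rewrite /kks_bracket -sumrMnl; apply: eq_bigr => i _; rewrite raddfMn
    mulrnAr.
have kMn m g : kap (g *+ m) = kap g *+ m by exact: raddfMn.
rewrite mulr1n raddfB /= Ek EP !Ek eu_kks fd he kksMnl kksMnr !kMn PAMnl PAMnr.
rewrite raddfB raddfD /= !kMn mulrnBl !mulrnDr.
move: (kap _) (pl_bracket _ _ _ _) => u v; ring.
Qed.

End Linearization.

(** * Taylor expansion along an invariant frame *)

Section EnvdualBasics.
Variables (k : fieldType) (a : lmodType k) (bk : a -> a -> a).
Local Notation O := (envdual bk).
Implicit Types (F G : O) (w : seq a).

Lemma envdualD F G w : (F + G) w = F w + G w. Proof. by []. Qed.
Lemma envdualZ (c : k) F w : (c *: F) w = c *: F w. Proof. by []. Qed.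
Lemma envdualM F G w : (F * G) w = \sum_(s <- coprod w) (F s.1 : k) * G s.2.
Proof. by []. Qed.

Lemma envdualM_nil F G : (F * G) [::] = (F [::] : k) * G [::].
Proof. by rewrite envdualM /= big_seq1. Qed.

Lemma envdualM_cons F G x w :
  (F * G) (x :: w) = (ltrans [:: x] F * G) w + (F * ltrans [:: x] G) w.
Proof. by rewrite !envdualM /= big_cat /= !big_map. Qed.

Lemma envdual_sum (I : Type) (s : seq I) (Q : pred I) (F : I -> O) w :
  (\sum_(i <- s | Q i) F i) w = \sum_(i <- s | Q i) F i w.
Proof. exact: (big_morph (fun F : O => F w) (fun F G => envdualD F G w)). Qed.

Lemma envdual_linear F u v : linear (fun x => F (u ++ x :: v)).
Proof. by have /envformP[] := envdualP F. Qed.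

Lemma envdual_swap F u x y v :
  F (u ++ x :: y :: v) - F (u ++ y :: x :: v) = F (u ++ bk x y :: v).
Proof. by have /envformP[_] := envdualP F; apply. Qed.

End EnvdualBasics.

(** * Series as linear forms on the enveloping algebra *)

Section Theta.
Variables (k : fieldType) (n : nat).
Hypothesis char0 : [pchar k] =i pred0.
Local Notation A := (symhat k n).
Local Notation fil := (@symhat_filt k n).
Implicit Types f h : A.

Variables U W : 'M[A]_n.
Hypothesis UW : U *m W = 1%:M.
Local Notation par i := (vf (U i)).
Variables D : 'I_n -> 'I_n -> 'I_n -> k.
Hypothesis parC : forall i j f,
  par i (par j f) - par j (par i f) = - \sum_l D i j l *: par l f.

Variables (a : lmodType k) (bk : a -> a -> a).
Variables (eps : 'I_n -> a) (x : 'I_n -> a -> k).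
Hypothesis x_linear : forall i c u v, x i (c *: u + v) = c * x i u + x i v.
Hypothesis x_eps : forall u, u = \sum_i x i u *: eps i.
Hypothesis x_delta : forall i j, x i (eps j) = (i == j)%:R.
Hypothesis x_bk : forall u v l,
  x l (bk u v) = \sum_i \sum_j D i j l * (x i u * x j v).
Local Notation O := (envdual bk).
Implicit Types (F G : O) (w : seq a).

Definition dpar (u : a) f : A := \sum_i x i u *: par i f.

Fact dpar_linear u : linear (dpar u).
Proof.
move=> c f h; rewrite /dpar scaler_sumr -big_split; apply: eq_bigr => i _ /=.
by rewrite linearP scalerDr !scalerA mulrC.
Qed.
HB.instance Definition _ u := GRing.isLinear.Build k A A _ (dpar u) (dpar_linear
  u).

Lemma dparM u f h : dpar u (f * h) = dpar u f * h + f * dpar u h.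
Proof.
rewrite /dpar mulr_suml mulr_sumr -big_split; apply: eq_bigr => i _ /=.
by rewrite vfM scalerDr scalerAl scalerAr.
Qed.

Lemma dpar_linearl c u v f : dpar (c *: u + v) f = c *: dpar u f + dpar v f.
Proof.
rewrite /dpar scaler_sumr -big_split; apply: eq_bigr => i _ /=.
by rewrite x_linear scalerDl scalerA.
Qed.

Lemma dparC u v f : dpar v (dpar u f) - dpar u (dpar v f) = dpar (bk u v) f.
Proof.
have E (u' v' : a) : dpar v' (dpar u' f) =
    \sum_i \sum_j (x i u' * x j v') *: par j (par i f).
  rewrite /dpar; under eq_bigr => j _.
    rewrite [par j (\sum_i _)]raddf_sum scaler_sumr.
    under eq_bigr => i _ do rewrite /= linearZ scalerA mulrC.
    over.
  by rewrite exchange_big.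
rewrite !E [X in _ - X]exchange_big -sumrB /=.
transitivity (\sum_i \sum_j (x i u * x j v) *: \sum_l D i j l *: par l f).
  apply: eq_bigr => i _; rewrite -sumrB; apply: eq_bigr => j _ /=.
  by rewrite [x j v * _]mulrC -scalerBr -opprB parC opprK.
rewrite /dpar; under [RHS]eq_bigr => l _.
  rewrite x_bk scaler_suml.
  under eq_bigr => i _ do rewrite scaler_suml.
  over.
rewrite [RHS]exchange_big; apply: eq_bigr => i _ /=.
rewrite [RHS]exchange_big; apply: eq_bigr => j _ /=.
by rewrite scaler_sumr; apply: eq_bigr => l _; rewrite scalerA mulrC.
Qed.

Lemma fil_dpar N u f : fil N.+1 f -> fil N (dpar u f).
Proof. by move=> fN; apply: fil_sum => i _; apply/filZ/fil_vf. Qed.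

(** The first letter acts first: the frame reverses brackets, and this order of composition reverses
    them back. *)
Definition taylor w f : A := foldl (fun f u => dpar u f) f w.

Lemma taylor_cons u w f : taylor (u :: w) f = taylor w (dpar u f). Proof. by [].
  Qed.
Lemma taylor_cat u w f : taylor (u ++ w) f = taylor w (taylor u f).
Proof. exact: foldl_cat. Qed.

Fact taylor_linear w : linear (taylor w).
Proof. by move=> c; elim: w => [//|u w IH] f h; rewrite !taylor_cons linearP IH.
  Qed.
HB.instance Definition _ w := GRing.isLinear.Build k A A _ (taylor w)
  (taylor_linear w).

Fact theta_envform f : (fun w => ev (taylor w f)) \in envform bk.
Proof.
apply/envformP; split=> [u v c y z|u y z v]; rewrite !taylor_cat !taylor_cons.
  by rewrite dpar_linearl !linearP.
by rewrite -dparC !raddfB.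
Qed.

Definition theta f : O := EnvDual (theta_envform f).

Lemma thetaE f w : theta f w = ev (taylor w f). Proof. by []. Qed.

Fact theta_linear : linear theta.
Proof. by move=> c f h; apply: envdual_eq => w; rewrite thetaE !linearP. Qed.
HB.instance Definition _ := GRing.isLinear.Build k A O _ theta theta_linear.

Lemma ltrans_theta u f : ltrans [:: u] (theta f) = theta (dpar u f).
Proof. exact: envdual_eq. Qed.

(** Letters are primitive for the coproduct, which matches the Leibniz rule of [dpar] along a
    word. *)
Lemma thetaM f h : theta (f * h) = theta f * theta h.
Proof.
apply: envdual_eq => w; elim: w f h => [|u w IH] f h.
  by rewrite envdualM_nil; apply: evM.
rewrite envdualM_cons !ltrans_theta -!IH -envdualD -raddfD -dparM.
by rewrite !thetaE.
Qed.

Lemma theta1 : theta 1 = 1.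
Proof.
apply: envdual_eq => -[|u w]; first by rewrite thetaE /= ev1.
rewrite thetaE taylor_cons [dpar u 1](_ : _ = 0) ?raddf0 //.
exact: (der_nat (dparM u) 1).
Qed.

Lemma fil_theta N f : fil N f -> envdual_filt N (theta f).
Proof.
move=> fN w; elim: w N f fN => [|u w IH] [|N] f fN //= wN.
  by apply/fil1_ev; apply: (fil_le _ fN).
by apply: (IH N (dpar u f)) => //; apply: fil_dpar.
Qed.

Local Notation lc i := (@ltrans k a bk [:: eps i]).
Local Notation eu_coef := (eu_coef W).

Lemma envdual_expand F u w : F (u :: w) = \sum_i x i u *: F (eps i :: w).
Proof.
have Flin := envdual_linear F [::] w; rewrite {1}(x_eps u).
have F0 : F (0 :: w) = 0.
  by apply: (@addrI _ (F (0 :: w))); rewrite addr0 -{3}[0]addr0 -{3}[0](scale1r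
    0) Flin scale1r.
elim/big_rec2: _ => [//|i y z _ <-]; exact: Flin.
Qed.

Lemma ltrans_linear (u : a) : linear (@ltrans k a bk [:: u]).
Proof. by move=> c F G; apply: envdual_eq. Qed.

Lemma lcC i j F : lc i (lc j F) = lc j (lc i F) - \sum_l D i j l *: lc l F.
Proof.
have x_bk_eps l : x l (bk (eps i) (eps j)) = D i j l.
  rewrite x_bk (bigD1 i) //= (bigD1 j) //= !x_delta !eqxx !mulr1.
  rewrite [\sum_(l0 | l0 != j) _]big1 => [|l0 /negPf lj]; last by rewrite
    !x_delta lj !mulr0.
  rewrite big1 ?addr0 // => i0 /negPf ii; rewrite big1 // => l0 _.
  by rewrite x_delta ii mul0r mulr0.
apply: envdual_eq => w; rewrite -[RHS]/(F [:: eps i, eps j & w] - (\sum_l D i j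
  l *: lc l F) w).
have /eqP := envdual_swap F [::] (eps i) (eps j) w; rewrite subr_eq /= => /eqP ->.
rewrite envdual_sum [F (bk _ _ :: _)]envdual_expand; under eq_bigr do rewrite
  x_bk_eps.
by apply: (canRL (addrK _)); apply: addrC.
Qed.

Lemma dpar_eps i f : dpar (eps i) f = par i f.
Proof.
rewrite /dpar (bigD1 i) //= x_delta eqxx scale1r big1 ?addr0 // => j /negPf ji.
by rewrite x_delta ji scale0r.
Qed.

(* The Taylor coefficients of f along the frame par determine f: the recursion
   eu f = \sum_i eu_coef i * par i f rebuilds f from its image under theta. *)
Lemma theta_inverse_exists : exists u : O -> A,
  (forall F, eu (u F) = \sum_i eu_coef i * u (lc i F)) /\ (forall F, ev (u F) =
    F [::]).
Proof.
have [|u uE] := @contraction_fix k n O (fun u F =>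
    (F [::] : k) *: (1 : A) + ieu 0 (\sum_i eu_coef i * u (lc i F))).
  move=> N u v uvN F; rewrite opprD addrACA subrr add0r -raddfB; apply: fil_ieu.
  rewrite -sumrB; apply: fil_sum => i _; rewrite -mulrBr -add1n.
  by apply: filM => //; apply: fil_eu_coef.
have S1 F : fil 1 (\sum_i eu_coef i * u (lc i F)).
  by apply: fil_sum => i _; apply/filMl/fil_eu_coef.
exists u; split=> F; rewrite -[in LHS]uE raddfD /=.
  by rewrite linearZ /= (der_nat (@euM k n) 1) scaler0 add0r eu_ieu0.
rewrite linearZ /= ev1 (fil1_ev _).1 ?addr0; last exact/fil_ieu/S1.
exact: mulr1.
Qed.

Variable u : O -> A.
Hypothesis eu_u : forall F, eu (u F) = \sum_i eu_coef i * u (lc i F).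
Hypothesis ev_u : forall F, ev (u F) = F [::].

Lemma theta_inv_linear : linear u.
Proof.
move=> c F G; pose z (p : O * O) := u (c *: p.1 + p.2) - (c *: u p.1 + u p.2).
suff z0 p : z p = 0 by apply/eqP; rewrite -subr_eq0; apply/eqP/(z0 (F, G)).
move: p; apply: contraction_eq0 => N IH [{}F {}G]; rewrite /z /=.
apply: (fil_eu_inv char0); first by apply/fil1_ev; rewrite raddfB /= linearP /=
  !ev_u subrr.
rewrite raddfB /= linearP /= !eu_u scaler_sumr -big_split -sumrB.
apply: fil_sum => i _ /=; rewrite scalerAr -mulrDr -mulrBr -add1n.
apply: filM; first exact: fil_eu_coef.
by rewrite ltrans_linear; apply: (IH (lc i F, lc i G)).
Qed.

Lemma theta_inv_fil N F : envdual_filt N F -> fil N (u F).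
Proof.
elim: N F => [//|N IH] F FN.
apply: (fil_eu_inv char0); first by apply/fil1_ev; rewrite ev_u FN.
rewrite eu_u; apply: fil_sum => i _; rewrite -add1n; apply: filM; first exact:
  fil_eu_coef.
by apply: IH => w wN; apply: (FN (eps i :: w)).
Qed.

Lemma thetaK : cancel theta u.
Proof.
move=> f; apply/eqP; rewrite -subr_eq0; apply/eqP; move: f.
apply: contraction_eq0 => N IH f.
apply: (fil_eu_inv char0).
  by apply/fil1_ev; rewrite raddfB /= ev_u thetaE subrr.
rewrite raddfB /= eu_u (eu_par UW) -sumrB; apply: fil_sum => i _.
rewrite ltrans_theta dpar_eps -mulrBr -add1n.
by apply: filM => //; apply: fil_eu_coef.
Qed.

Lemma fil_par_eu_coef i j : fil 1 (par i (eu_coef j) - (i == j)%:R).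
Proof.
rewrite [par i _]raddf_sum /=; under eq_bigr do rewrite vfM vf_X.
rewrite big_split /=; have -> : \sum_m U i m * W m j = (i == j)%:R.
  by have := congr1 (fun M : 'M_n => M i j) UW; rewrite /= !mxE.
by rewrite addrAC subrr add0r; apply: fil_sum => m _; apply/filMl/fil_X.
Qed.

Lemma eu_parC i f :
  eu (par i f) = par i (eu f) + \sum_j \sum_l D i j l *: (eu_coef j * par l f)
                 - \sum_j par i (eu_coef j) * par j f.
Proof.
rewrite !(eu_par UW) [par i (\sum_j _)]raddf_sum -big_split -sumrB.
apply: eq_bigr => j _ /=.
have -> : par j (par i f) = par i (par j f) + \sum_l D i j l *: par l f.
  by have /eqP := parC i j f; rewrite subr_eq => /eqP ->; ring.
by rewrite vfM mulrDr mulr_sumZ; ring.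
Qed.

(** The recursion defining u prescribes only the radial derivative of [u F]; here all frame
    derivatives are recovered. The relations of the frame and of the left translations agree, so the
    defect Y solves a homogeneous linear equation and vanishes by contraction. *)
Lemma par_theta_inv i F : par i (u F) = u (lc i F).
Proof.
pose Y (p : 'I_n * O) := par p.1 (u p.2) - u (lc p.1 p.2).
suff Y0 p : Y p = 0 by apply/eqP; rewrite -subr_eq0; apply/eqP/(Y0 (i, F)).
move: p; apply: contraction_eq0 => N IH [{}i {}F].
apply: (@fil_euS_inv _ _ char0 1) => //.
have usum (F' : 'I_n -> O) : u (\sum_l F' l) = \sum_l u (F' l).
  elim/big_rec2: _ => [|l y z _ <-].
    by have := theta_inv_linear (-1) 0 0; rewrite scaler0 addr0 scaleN1r addNr.
  by have := theta_inv_linear 1 (F' l) z; rewrite !scale1r.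
(* The constant term of [par i (eu_coef j)] is the Kronecker delta; moved to the left it gives the
   summand Y, and every coefficient left on the right is in step 1. *)
suff -> : eu (Y (i, F)) + Y (i, F) *+ 1 =
   - \sum_j (par i (eu_coef j) - (i == j)%:R) * Y (j, F) + \sum_j eu_coef j * Y
     (i, lc j F)
   + \sum_j \sum_l D i j l *: (eu_coef j * Y (l, F)).
  apply: filD; first (apply: filD; first apply: filN).
  - by apply: fil_sum => j _; rewrite -add1n; apply: filM; [apply:
    fil_par_eu_coef|].
  - by apply: fil_sum => j _; rewrite -add1n; apply: filM; [apply: fil_eu_coef|].
  - apply: fil_sum => j _; apply: fil_sum => l _; apply: filZ; rewrite -add1n.
    by apply: filM; [apply: fil_eu_coef|].
rewrite /Y /= mulr1n raddfB /= eu_parC !eu_u [par i (\sum_j _)]raddf_sum /=.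
under [\sum_j par i _]eq_bigr do rewrite vfM.
have uZ c G : u (c *: G) = c *: u G.
  have u0 : u 0 = 0 by have := theta_inv_linear (-1) 0 0; rewrite scaler0 addr0
    scaleN1r addNr.
  by have := theta_inv_linear c G 0; rewrite u0 !addr0.
have u_lcC j : u (lc j (lc i F)) =
    u (lc i (lc j F)) + \sum_l D i j l *: u (lc l F).
  rewrite (_ : lc j (lc i F) = 1 *: lc i (lc j F) + \sum_l D i j l *: lc l F).
    rewrite theta_inv_linear scale1r usum; congr (_ + _).
    by apply: eq_bigr => l _; rewrite uZ.
  by rewrite scale1r [lc i (lc j F)]lcC subrK.
under [\sum_j eu_coef j * _]eq_bigr do rewrite u_lcC mulrDr.
have -> : \sum_j (par i (eu_coef j) - (i == j)%:R) * (par j (u F) - u (lc j F)) =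
    \sum_j par i (eu_coef j) * (par j (u F) - u (lc j F)) - (par i (u F) - u (lc
      i F)).
  under eq_bigr do rewrite mulrBl.
  rewrite sumrB; congr (_ - _); rewrite (bigD1 i) //= eqxx mul1r big1 ?addr0 //
    => j ji.
  by rewrite eq_sym (negPf ji) mul0r.
transitivity (\sum_j (par i (eu_coef j) * u (lc j F) + eu_coef j * par i (u (lc
  j F))
    + \sum_l D i j l *: (eu_coef j * par l (u F)) - par i (eu_coef j) * par j (u
      F)
    - (eu_coef j * u (lc i (lc j F)) + eu_coef j * (\sum_l D i j l *: u (lc l
      F))))
    + (par i (u F) - u (lc i F))); first by rewrite !sumrB !big_split.
rewrite opprB addrC -[RHS]addrA -[RHS]addrA; congr (_ + _).
rewrite [RHS]addrC -big_split -sumrB; apply: eq_bigr => j _ /=.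
have -> : \sum_l D i j l *: (eu_coef j * (par l (u F) - u (lc l F))) =
    \sum_l D i j l *: (eu_coef j * par l (u F)) - eu_coef j * (\sum_l D i j l *:
      u (lc l F)).
  by rewrite mulr_sumZ -sumrB; apply: eq_bigr => l _; rewrite mulrBr scalerBr.
by ring.
Qed.

Lemma theta_invK : cancel u theta.
Proof.
move=> F; apply: envdual_eq => w; elim: w F => [|z w IH] F; first exact: ev_u.
rewrite -[LHS]/(theta (dpar z (u F)) w) envdual_expand.
have -> : theta (dpar z (u F)) = \sum_i x i z *: theta (u (lc i F)).
  by rewrite raddf_sum; apply: eq_bigr => i _; rewrite /= linearZ /=
    par_theta_inv.
by rewrite envdual_sum; apply: eq_bigr => i _; rewrite envdualZ IH.
Qed.

(* A multiplicative bracket is determined by its linearization, as both sides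
   satisfy the recursion of par_pl_bracket along words. *)
Section PoissonBracket.
Variable C : 'I_n -> 'I_n -> 'I_n -> k.
Local Notation rho i := (vf (lvf (\matrix_(j, l) C i j l))).
Hypothesis rho_parC : forall i j f,
  rho i (par j f) - par j (rho i f) =
  - \sum_l C i l j *: par l f - \sum_l D j l i *: rho l f.
Variable P : O -> O -> O.
Hypothesis P_mult : is_multiplicative P.
Hypothesis P_lin : forall F G z,
  P F G [:: z] = \sum_m x m z *: \sum_i \sum_j C i j m *: (F [:: eps i] * G [::
    eps j] : k^o).

(** Multiplicativity on two empty words doubles the value: the bivector vanishes at the unit. *)
Lemma P_nil F G : P F G [::] = 0.
Proof.
have := P_mult F G [::] [::]; rewrite /= !big_seq1 /=.
have r0 H : rtrans [::] H = H by apply: envdual_eq => w /=; rewrite cats0.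
have l0 H : ltrans [::] H = H by apply: envdual_eq.
by rewrite !r0 !l0 => /eqP; rewrite -subr_eq subrr eq_sym => /eqP.
Qed.

(** Multiplicativity after splitting off one letter: its primitive coproduct gives the translated
    terms, and the other sum involves P only on one-letter words, known from [P_lin]. *)
Lemma P_cons F G z w :
  P F G (z :: w) = P (ltrans [:: z] F) G w + P F (ltrans [:: z] G) w
    + \sum_m x m z *: \sum_i \sum_j C i j m *: (lc i F * lc j G) w.
Proof.
have l0 H : ltrans [::] H = H by apply: envdual_eq.
rewrite -[z :: w]/([:: z] ++ w) P_mult addrC; congr (_ + _).
  by rewrite /= big_cons big_seq1 /= !l0.
under eq_bigr do rewrite P_lin.
rewrite exchange_big; apply: eq_bigr => m _ /=; rewrite -scaler_sumr; congr (_
  *: _).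
rewrite exchange_big; apply: eq_bigr => i _.
rewrite exchange_big; apply: eq_bigr => j _.
by rewrite [RHS]scaler_sumr.
Qed.

Lemma dpar_pl_bracket z f h : dpar z (pl_bracket U C f h) =
  pl_bracket U C (dpar z f) h + pl_bracket U C f (dpar z h)
  + \sum_m x m z *: \sum_i \sum_j C i j m *: (par i f * par j h).
Proof.
have PAl (v : 'I_n -> A) : pl_bracket U C (\sum_m x m z *: v m) h =
    \sum_m x m z *: pl_bracket U C (v m) h.
  elim/big_rec2: _ => [|m p q _ <-]; last exact: pl_bracket_linearl.
  by rewrite /pl_bracket big1 // => i _; rewrite raddf0 mul0r.
have PAr (v : 'I_n -> A) : pl_bracket U C f (\sum_m x m z *: v m) =
    \sum_m x m z *: pl_bracket U C f (v m).
  elim/big_rec2: _ => [|m p q _ <-]; last exact: pl_bracket_linearr.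
  by rewrite /pl_bracket big1 // => i _; rewrite raddf0 mulr0.
rewrite /dpar PAl PAr -!big_split; apply: eq_bigr => m _ /=.
by rewrite (par_pl_bracket parC rho_parC) !scalerDr.
Qed.

Lemma theta_pl_bracket f h : theta (pl_bracket U C f h) = P (theta f) (theta h).
Proof.
apply: envdual_eq => w; elim: w f h => [|z w IH] f h.
  rewrite P_nil; apply/fil1_ev; apply: fil_sum => i _; apply: filMr (fil_rho1 _
    _ _).
  by [].
rewrite P_cons !ltrans_theta -!IH -[LHS]/(theta (dpar z (pl_bracket U C f h)) w).
under eq_bigr => m _ do under eq_bigr => i _ do under eq_bigr => j _
  do rewrite !ltrans_theta !dpar_eps -thetaM.
have -> : theta (dpar z (pl_bracket U C f h)) =
    theta (pl_bracket U C (dpar z f) h) + theta (pl_bracket U C f (dpar z h))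
    + \sum_m x m z *: \sum_i \sum_j C i j m *: theta (par i f * par j h).
  rewrite dpar_pl_bracket 2!raddfD /=; congr (_ + _).
  rewrite raddf_sum; apply: eq_bigr => m _; rewrite /= linearZ /=; congr (_ *: _).
  rewrite raddf_sum; apply: eq_bigr => i _; rewrite /= raddf_sum.
  by apply: eq_bigr => j _; rewrite /= linearZ.
rewrite !envdualD; congr (_ + _); rewrite envdual_sum; apply: eq_bigr => m _.
rewrite envdualZ envdual_sum; congr (_ *: _); apply: eq_bigr => i _.
by rewrite envdual_sum; apply: eq_bigr => j _; rewrite envdualZ.
Qed.

End PoissonBracket.

End Theta.

(** * Structure constants of the double *)

Section StructureConstants.
Variables (k : fieldType) (g : vectType k) (b : g -> g -> g).
Local Notation n := (\dim {:g}).
Local Notation e i := (vbasis {:g})`_i.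
Variable r : 'M[k]_n.
Hypothesis qt : is_quasitriangular b r.
Implicit Types (x y z : g) (i j l m p q : 'I_n).

HB.instance Definition _ i := GRing.Linear.copy (@crd k g i) (coord (vbasis
  {:g}) i).

Lemma crd_basis i j : crd i (e j) = (i == j)%:R.
Proof. by rewrite /crd coord_free ?(basis_free (vbasisP _)) // eq_sym. Qed.

Lemma crd_sum x : x = \sum_i crd i x *: e i.
Proof. exact: coord_vbasis (memvf x). Qed.

Lemma crd_eq x y : (forall i, crd i x = crd i y) -> x = y.
Proof. by move=> xy; rewrite [x]crd_sum [y]crd_sum; apply: eq_bigr => i _;
  rewrite xy. Qed.

Let lie := qt_lie qt.

Lemma b_suml (I : finType) (c : I -> k) (v : I -> g) y :
  b (\sum_i c i *: v i) y = \sum_i c i *: b (v i) y.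
Proof.
have bl := lie_linearl lie y; elim/big_rec2: _ => [|i p q _ <-]; last exact: bl.
by have := bl (-1) 0 0; rewrite scaler0 addr0 scaleN1r addNr.
Qed.

Lemma b_sumr (I : finType) (c : I -> k) (v : I -> g) x :
  b x (\sum_i c i *: v i) = \sum_i c i *: b x (v i).
Proof.
have br := lie_linearr lie x; elim/big_rec2: _ => [|i p q _ <-]; last exact: br.
by have := br (-1) 0 0; rewrite scaler0 addr0 scaleN1r addNr.
Qed.

Lemma b_anti x y : b x y = - b y x.
Proof.
apply/eqP; rewrite -addr_eq0; apply/eqP.
have /= := lie_alternating lie (x + y).
have := lie_linearl lie (x + y) 1 x y; rewrite !scale1r => ->.
have := lie_linearr lie x 1 x y; rewrite !scale1r => ->.
have := lie_linearr lie y 1 x y; rewrite !scale1r => ->.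
by rewrite !(lie_alternating lie) add0r addr0.
Qed.

Lemma bNr x y : b x (- y) = - b x y.
Proof.
have b0 : b x 0 = 0.
  by have := lie_linearr lie x (-1) 0 0; rewrite scaler0 addr0 scaleN1r addNr.
by have := lie_linearr lie x (-1) y 0; rewrite b0 !addr0 !scaleN1r.
Qed.

Lemma b_jacobi x y z : b x (b y z) = b (b x y) z + b y (b x z).
Proof.
have /eqP := lie_jacobi lie x y z; rewrite (b_anti z x) bNr (b_anti z) -addrA.
by rewrite -opprD subr_eq0 addrC => /eqP.
Qed.

Definition lie_const i j l := crd l (b (e i) (e j)).
Definition dual_const i j l := cobracket b r (e l) i j.
Local Notation C := lie_const.
Local Notation D := dual_const.
Local Notation t := (r + r^T).

Lemma lie_const_anti i j l : C i j l = - C j i l.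
Proof. by rewrite /C b_anti linearN. Qed.

Lemma ad2E x (s : 'M[k]_n) i j : ad2 b x s i j =
  \sum_p s p j * crd i (b x (e p)) + \sum_p s i p * crd j (b x (e p)).
Proof.
have delta (F : 'I_n -> k) q : \sum_p F p * (q == p)%:R = F q.
  rewrite (bigD1 q) //= eqxx mulr1 big1 ?addr0 // => p /negPf pq.
  by rewrite eq_sym pq mulr0.
rewrite /ad2 summxE; under eq_bigr => p _ do rewrite summxE.
transitivity (\sum_p (\sum_q s p q * crd i (b x (e p)) * (j == q)%:R
    + (\sum_q s p q * crd j (b x (e q))) * (i == p)%:R)).
  apply: eq_bigr => p _; rewrite mulr_suml -big_split; apply: eq_bigr => q _.
  by rewrite !mxE !crd_basis /=; ring.
rewrite big_split /= delta; congr (_ + _).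
by apply: eq_bigr => p _; rewrite delta.
Qed.

Lemma dual_constE i j l : D i j l = \sum_p r p j * C l p i + \sum_p r i p * C l
  p j.
Proof. exact: ad2E. Qed.

Lemma invariance x i j :
  \sum_p t p j * crd i (b x (e p)) + \sum_p t i p * crd j (b x (e p)) = 0.
Proof. by rewrite -ad2E (qt_invariant qt) mxE. Qed.

Lemma t_sym i j : t i j = t j i.
Proof. by rewrite !mxE addrC. Qed.

(** The symmetric part of the cobracket is the action of g on t, which is zero by invariance. *)
Lemma dual_const_anti i j l : D i j l = - D j i l.
Proof.
apply/eqP; rewrite -addr_eq0 !dual_constE; apply/eqP; rewrite -[RHS](invariance
  (e l) i j).
by rewrite -!big_split; apply: eq_bigr => p _; rewrite !mxE /C /=; ring.
Qed.

(* The image by t : g^* -> g of the i-th element of the dual basis. *)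
Definition tvec i : g := \sum_p t i p *: e p.

Lemma crd_b x y l : crd l (b x y) = \sum_p crd p y * crd l (b x (e p)).
Proof.
rewrite {1}[y]crd_sum b_sumr linear_sum; apply: eq_bigr => p _ /=.
by rewrite linearZ.
Qed.

Lemma crd_tvec i j : crd j (tvec i) = t i j.
Proof.
rewrite linear_sum (bigD1 j) //= linearZ /= crd_basis eqxx mulr1 big1 ?addr0 //
  => p /negPf pj.
by rewrite linearZ /= crd_basis eq_sym pj mulr0.
Qed.

(** Invariance of t, read as equivariance of t : g^* -> g for the coadjoint action. *)
Lemma b_tvec x j : b x (tvec j) = - \sum_(m < n) crd j (b x (e m)) *: tvec m.
Proof.
apply: crd_eq => i; rewrite linearN linear_sum crd_b /=.
apply/eqP; rewrite -addr_eq0; apply/eqP; rewrite -[RHS](invariance x i j).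
congr (_ + _); apply: eq_bigr => p _; first by rewrite crd_tvec t_sym.
by rewrite linearZ /= crd_tvec t_sym mulrC.
Qed.

(* Structure constants of the Lie bracket [xi, eta] = ad^*_{t xi} eta on g^*. *)
Definition coad_const i j l : k := - crd j (b (tvec i) (e l)).
Local Notation c := coad_const.

Lemma coad_constE i j l : c i j l = - \sum_m t i m * C m l j.
Proof.
by rewrite /c b_suml linear_sum; congr (- _); apply: eq_bigr => m _; rewrite /=
  linearZ.
Qed.

Lemma coad_const_anti i j l : c i j l = - c j i l.
Proof.
apply/eqP; rewrite -addr_eq0 /c -opprD oppr_eq0; apply/eqP.
rewrite !(b_anti (tvec _)) !b_tvec !opprK !linear_sum /= -[RHS](invariance (e l)
  i j).
congr (_ + _); apply: eq_bigr => p _; rewrite linearZ /= crd_tvec mulrC //.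
by rewrite t_sym.
Qed.

Lemma coad_const_tvec i j : \sum_m c i j m *: tvec m = b (tvec i) (tvec j).
Proof. by rewrite b_tvec -sumrN; apply: eq_bigr => m _; rewrite scaleNr. Qed.

(** By [coad_const_tvec] the map t preserves brackets, so this is the fact that ad^* is a
    representation of g. *)
Lemma coad_const_jacobi i j p q :
  \sum_m c j p m * c i m q = \sum_m c i j m * c m p q + \sum_m c i p m * c j m q.
Proof.
have E (i' j' : 'I_n) : \sum_m c j' p m * c i' m q =
    crd p (b (tvec j') (b (tvec i') (e q))).
  by rewrite crd_b; apply: eq_bigr => m _; rewrite mulrNN mulrC.
rewrite !E b_jacobi linearD /=; congr (_ + _).
have -> : b (tvec j) (tvec i) = - \sum_m c i j m *: tvec m.
  by rewrite coad_const_tvec b_anti.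
rewrite b_anti bNr opprK b_anti b_suml linearN linear_sum -sumrN.
by apply: eq_bigr => m _ /=; rewrite linearZ /= mulrN.
Qed.

(** Equivariance of t makes g act by derivations, as the semidirect product requires. *)
Lemma coad_const_der x i j l :
  \sum_(m < n) crd i (b x (e m)) * c m j l + \sum_(m < n) crd j (b x (e m)) * c
    i m l
  = \sum_m c i j m * crd m (b x (e l)).
Proof.
rewrite [X in _ + X](_ : _ = - crd j (b x (b (tvec i) (e l)))); last first.
  by rewrite [in RHS]crd_b -sumrN; apply: eq_bigr => m _; rewrite mulrN mulrC.
rewrite [RHS](_ : _ = - crd j (b (tvec i) (b x (e l)))); last first.
  by rewrite [in RHS]crd_b -sumrN; apply: eq_bigr => m _; rewrite mulNr mulrC.
rewrite [X in X + _](_ : _ = crd j (b (b x (tvec i)) (e l))); last first.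
  rewrite b_tvec [b (- _) _]b_anti bNr opprK b_anti b_suml linearN linear_sum
    -sumrN.
  by apply: eq_bigr => m _; rewrite /= linearZ /= mulrN.
by rewrite b_jacobi linearD /= opprD addrA subrr add0r.
Qed.

(** On g^* the bracket of xi and eta is ad^*_{r xi} eta - ad^*_{r eta} xi - ad^*_{t xi} eta: the
    component along the ideal when xi is split as (xi - r xi) + r xi in the double. *)
Lemma dual_const_coad i j l :
  D i j l = - c i j l - \sum_p r i p * C p l j + \sum_p r j p * C p l i.
Proof.
rewrite coad_constE opprK dual_constE; apply/eqP; rewrite -subr_eq0; apply/eqP.
rewrite -[RHS](invariance (e l) i j) -!sumrB -!big_split -sumrB /=.
by apply: eq_bigr => p _; rewrite !mxE (lie_const_anti p l j) (lie_const_anti p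
  l i) /C; ring.
Qed.

Lemma lie_const_jacobi i j p l :
  \sum_q C j p q * C i q l - \sum_q C i p q * C j q l = \sum_q C i j q * C q p l.
Proof.
have E (i' j' : 'I_n) : \sum_q C j' p q * C i' q l = crd l (b (e i') (b (e j')
  (e p))).
  by rewrite [in RHS]crd_b.
rewrite !E b_jacobi linearD addrK.
by rewrite {1}[b (e i) (e j)]crd_sum b_suml linear_sum; apply: eq_bigr => q _;
  rewrite /= linearZ.
Qed.

(** The Yang-Baxter equation as the statement that r : g^* -> g preserves brackets. *)
Lemma dual_const_cybe i j l :
  \sum_m D i j m * r m l = \sum_p \sum_q r i p * r j q * C p q l.
Proof.
have := congr1 (fun F : {ffun 'I_n * 'I_n * 'I_n -> k^o} => F (i, j, l))
  (qt_cybe qt).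
have delta (F : 'I_n -> k) q : \sum_p F p * (q == p)%:R = F q.
  rewrite (bigD1 q) //= eqxx mulr1 big1 ?addr0 // => p /negPf pq.
  by rewrite eq_sym pq mulr0.
have -> : cybe b r (i, j, l) =
    \sum_p \sum_s r p j * r s l * C p s i + \sum_q \sum_s r i q * r s l * C q s j
    + \sum_q \sum_m r i q * r j m * C q m l.
  rewrite /cybe; transitivity (\sum_p \sum_q \sum_s \sum_m
      (r p q * r s m * C p s i * (j == q)%:R * (l == m)%:R
       + r p q * r s m * C q s j * (i == p)%:R * (l == m)%:R
       + r p q * r s m * C q m l * (i == p)%:R * (j == s)%:R)).
    rewrite sum_ffunE; apply: eq_bigr => p _; rewrite sum_ffunE; apply: eq_bigr
      => q _.
    rewrite sum_ffunE; apply: eq_bigr => s _; rewrite sum_ffunE; apply: eq_bigr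
      => m _.
    by rewrite !ffunE /= !crd_basis /C -[LHS]/(_ * _); ring.
  transitivity (\sum_p \sum_q ((\sum_s r p q * r s l * C p s i) * (j == q)%:R
      + (\sum_s r p q * r s l * C q s j) * (i == p)%:R
      + (\sum_m r p q * r j m * C q m l) * (i == p)%:R)).
    apply: eq_bigr => p _; apply: eq_bigr => q _.
    under eq_bigr => s _ do rewrite !big_split /= !delta.
    rewrite !big_split /= -!mulr_suml; congr (_ + _); rewrite exchange_big
      mulr_suml.
    by apply: eq_bigr => m _ /=; rewrite delta.
  under eq_bigr => p _ do rewrite !big_split /= delta -!mulr_suml.
  by rewrite !big_split /= !delta.
rewrite ffunE addrC => /eqP; rewrite addr_eq0 => /eqP ->.
rewrite exchange_big [X in _ + X]exchange_big -big_split -sumrN.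
apply: eq_bigr => m _; rewrite dual_constE mulrDl !mulr_suml -!big_split -sumrN
  /=.
by apply: eq_bigr => p _; rewrite (lie_const_anti m p i) (lie_const_anti m p j);
  ring.
Qed.

Lemma dual_b (xi : dual g) x y : xi (b x y) =
  \sum_(m < n) (xi (e m) : k) * \sum_i \sum_j C i j m * (crd i x * crd j y).
Proof.
have crd_bb m : crd m (b x y) = \sum_i \sum_j C i j m * (crd i x * crd j y).
  rewrite {1}[x]crd_sum b_suml linear_sum; apply: eq_bigr => i _ /=.
  rewrite linearZ /= crd_b mulr_sumr; apply: eq_bigr => j _.
  by rewrite -[RHS]/(_ * _) /C; ring.
rewrite {1}[b x y]crd_sum linear_sum; apply: eq_bigr => m _ /=.
by rewrite linearZ -crd_bb; apply: mulrC.
Qed.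

End StructureConstants.

Lemma exchange_sumZ (k : fieldType) (V : lmodType k) (m n : nat)
    (c : 'I_m -> k) (d : 'I_m -> 'I_n -> k) (v : 'I_n -> V) :
  \sum_i c i *: (\sum_j d i j *: v j) = \sum_j (\sum_i c i * d i j) *: v j.
Proof.
under eq_bigr do rewrite scaler_sumr.
rewrite exchange_big; apply: eq_bigr => j _; rewrite scaler_suml.
by apply: eq_bigr => i _; rewrite scalerA.
Qed.

(** * The action of the double by vector fields *)

Section DoubleAction.
Variables (k : fieldType) (g : vectType k) (b : g -> g -> g).
Hypothesis char0 : [pchar k] =i pred0.
Local Notation n := (\dim {:g}).
Local Notation e i := (vbasis {:g})`_i.
Variable r : 'M[k]_n.
Hypothesis qt : is_quasitriangular b r.
Local Notation A := (symhat k n).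
Local Notation fil := (@symhat_filt k n).
Local Notation C := (lie_const b).
Local Notation D := (dual_const b r).
Local Notation c := (coad_const b r).
Local Notation rho i := (vf (lvf (\matrix_(j, l) C i j l))).

Lemma rho_bracket i j f : rho i (rho j f) - rho j (rho i f) = \sum_l C i j l *:
  rho l f.
Proof.
rewrite vf_lvfC /vf; under [RHS]eq_bigr do rewrite scaler_sumr.
rewrite exchange_big; apply: eq_bigr => p _ /=.
under [RHS]eq_bigr do rewrite scalerAl; rewrite -mulr_suml; congr (_ * _).
rewrite /lvf; under [RHS]eq_bigr do rewrite scaler_sumr.
rewrite exchange_big; apply: eq_bigr => l _ /=.
under [RHS]eq_bigr do rewrite mxE scalerA; rewrite -scaler_suml; congr (_ *: _).
rewrite -(lie_const_jacobi qt) !mxE; congr (_ - _); apply: eq_bigr => q _;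
  rewrite !mxE //.
Qed.

(* The dressing action of d = g + g^* on the formal group G^*, transported to
   power series on g^*: g acts by coadjoint vector fields rho, and g^* by the
   frame vf (U i). *)
Lemma dressing_frame : exists U : 'M[A]_n,
  [/\ forall i j, fil 1 (U i j - (i == j)%:R),
      forall i j f, vf (U i) (vf (U j) f) - vf (U j) (vf (U i) f) =
        - \sum_l D i j l *: vf (U l) f
    & forall i j f, rho i (vf (U j) f) - vf (U j) (rho i f) =
        - \sum_l C i l j *: vf (U l) f - \sum_l D j l i *: rho l f].
Proof.
have [th thE] := mc_form_exists char0 c.
have thf := th_fil char0 thE.
have [T thT] := right_inverse_mx thf.
have nabC := nabC char0 (coad_const_anti qt) (coad_const_jacobi qt) thE thT.
have rho_nab x i f : rho x (vf (T i) f) - vf (T i) (rho x f) =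
    - \sum_m C x m i *: vf (T m) f.
  rewrite (rho_nabC char0 thE thT); last first.
    move=> i' j l; under eq_bigr do rewrite mxE.
    under [X in _ + X]eq_bigr do rewrite mxE.
    under [RHS]eq_bigr do rewrite mxE; exact: coad_const_der.
  by under eq_bigr do rewrite mxE.
pose R i := vf (lvf (\matrix_(j, l) \sum_p r i p * C p j l)).
have RE i f : R i f = \sum_p r i p *: rho p f.
  rewrite /R /vf; under [RHS]eq_bigr do rewrite scaler_sumr.
  rewrite [RHS]exchange_big; apply: eq_bigr => j _ /=.
  under [RHS]eq_bigr do rewrite scalerAl; rewrite -mulr_suml; congr (_ * _).
  rewrite /lvf; under [RHS]eq_bigr do rewrite scaler_sumr.
  rewrite [RHS]exchange_big; apply: eq_bigr => l _ /=; rewrite mxE scaler_suml.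
  by apply: eq_bigr => p _; rewrite mxE scalerA.
(* In xi = (xi - r xi) + r xi, the ideal acts by the invariant frame T and r xi by [- R], since e_p
   acts by [- rho p]. *)
pose U : 'M[A]_n := \matrix_(i, j) (T i j - lvf (\matrix_(j, l) \sum_p r i p * C
  p j l) j).
have UE i f : vf (U i) f = vf (T i) f - R i f.
  by rewrite /R /vf -sumrB; apply: eq_bigr => j _; rewrite mxE mulrBl.
have nabR i j f : vf (T i) (R j f) - R j (vf (T i) f) =
    \sum_m (\sum_q r j q * C q m i) *: vf (T m) f.
  rewrite !RE [vf (T i) (\sum_p _)]raddf_sum -sumrB.
  under [RHS]eq_bigr do rewrite scaler_suml.
  rewrite [RHS]exchange_big; apply: eq_bigr => q _ /=; rewrite linearZ -scalerBr
    /=.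
  rewrite -opprB rho_nab opprK scaler_sumr.
  by apply: eq_bigr => m _; rewrite scalerA.
have RR i j f : R i (R j f) - R j (R i f) =
    \sum_l (\sum_p \sum_q r i p * r j q * C p q l) *: rho l f.
  have RRE (u v : 'I_n) : R u (R v f) =
      \sum_p \sum_q (r u p * r v q) *: rho p (rho q f).
    rewrite RE; apply: eq_bigr => p _; rewrite RE [rho p _]raddf_sum scaler_sumr.
    by apply: eq_bigr => q _ /=; rewrite linearZ /= scalerA.
  rewrite !RRE [X in _ - X]exchange_big -sumrB /=.
  under [RHS]eq_bigr do rewrite scaler_suml.
  rewrite [RHS]exchange_big; apply: eq_bigr => p _ /=.
  under [RHS]eq_bigr do rewrite scaler_suml.
  rewrite [RHS]exchange_big -sumrB; apply: eq_bigr => q _ /=.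
  rewrite [r j q * _]mulrC -scalerBr rho_bracket scaler_sumr.
  by apply: eq_bigr => l _; rewrite scalerA.
exists U; split.
- move=> i j; rewrite mxE addrAC; apply: filB; last exact: fil_lvf.
  exact: (fil_invT char0 thE thT).
- move=> i j f; rewrite !UE.
  have -> : vf (T i) (vf (T j) f - R j f) - R i (vf (T j) f - R j f)
      - (vf (T j) (vf (T i) f - R i f) - R j (vf (T i) f - R i f)) =
    (vf (T i) (vf (T j) f) - vf (T j) (vf (T i) f))
    - (vf (T i) (R j f) - R j (vf (T i) f)) + (vf (T j) (R i f) - R i (vf (T j)
      f))
    + (R i (R j f) - R j (R i f)).
    by rewrite [vf (T i) (_ - _)]raddfB [vf (T j) (_ - _)]raddfB
      [R i (_ - _)]raddfB [R j (_ - _)]raddfB /=; ring.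
  (* The [rho] terms agree by the Yang-Baxter equation and the terms in T by [dual_const_coad]. *)
  rewrite nabC !nabR RR.
  under [\sum_l D i j l *: _]eq_bigr => l _ do rewrite UE scalerBr RE.
  rewrite sumrB opprB addrC; congr (_ + _).
    rewrite exchange_sumZ; apply: eq_bigr => l _.
    by rewrite (dual_const_cybe qt).
  rewrite -[RHS]sumrN -sumrB -big_split; apply: eq_bigr => l _ /=.
  by rewrite (dual_const_coad qt) -[RHS]scaleNr -scalerBl -scalerDl; congr (_ *:
    _); ring.
- move=> i j f; rewrite !UE.
  have rhoR : rho i (R j f) - R j (rho i f) =
      \sum_l (\sum_p r j p * C i p l) *: rho l f.
    rewrite !RE [rho i _]raddf_sum -sumrB; under [RHS]eq_bigr do rewrite
      scaler_suml.
    rewrite [RHS]exchange_big; apply: eq_bigr => p _ /=.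
    rewrite linearZ /= -scalerBr rho_bracket scaler_sumr.
    by apply: eq_bigr => l _; rewrite scalerA.
  have -> : rho i (vf (T j) f - R j f) - (vf (T j) (rho i f) - R j (rho i f)) =
      (rho i (vf (T j) f) - vf (T j) (rho i f)) - (rho i (R j f) - R j (rho i f)).
    by rewrite [rho i (_ - _)]raddfB /=; ring.
  rewrite rho_nab rhoR.
  under [\sum_l C i l j *: vf (U l) f]eq_bigr => l _ do rewrite UE scalerBr RE.
  rewrite sumrB exchange_sumZ opprD opprK -[RHS]addrA; congr (_ + _).
  rewrite -[LHS]sumrN -[RHS]sumrB; apply: eq_bigr => l _.
  rewrite -scalerBl -scaleNr; congr (_ *: _); rewrite dual_constE opprD addrA.
  by rewrite [X in X - _ - _](_ : _ = \sum_p r p l * C i p j);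
    [rewrite subrr sub0r | apply: eq_bigr => p _; rewrite mulrC].
Qed.

End DoubleAction.

(** * The isomorphism *)

Lemma lie_poissonE (k : fieldType) (g : vectType k) (b : g -> g -> g)
    (f h : symhat k (\dim {:g})) : lie_poisson b f h = kks_bracket (lie_const b)
      f h.
Proof.
have shsum (F : 'I_(\dim {:g}) -> symhat k (\dim {:g})) d : (\sum_i F i) d =
  \sum_i F i d.
  exact: (big_morph (fun h : symhat k _ => h d) (fun f g => symhatDE f g d)
    (symhat0E k _ d)).
have rhoE i d : vf (lvf (\matrix_(j, l) lie_const b i j l)) h d =
    \sum_(j < \dim {:g}) linpoly (b (vbasis {:g})`_i (vbasis {:g})`_j) * (h
      d)^`M(j).
  rewrite shsum; apply: eq_bigr => j _.
  have lvfE m : lvf (\matrix_(j, l) lie_const b i j l) j m =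
      if m == 1%N then linpoly (b (vbasis {:g})`_i (vbasis {:g})`_j) else 0.
    rewrite shsum; case: eqP => [->|/eqP m1].
      by apply: eq_bigr => l _; rewrite symhatZE symhat_XE eqxx mxE.
    by rewrite big1 // => l _; rewrite symhatZE symhat_XE (negPf m1) scaler0.
  rewrite symhatME; case: d => [|d].
    by rewrite big_ord1 lvfE /= mul0r dhomog0_mderiv ?symhat_homog // mulr0.
  rewrite big_ord_recl big_ord_recl big1 => [|m _]; last by rewrite lvfE /= mul0r.
  by rewrite !lvfE /= mul0r add0r addr0 subn1.
apply: symhat_eq => d; rewrite [RHS]shsum -[LHS]/(lp_seq b f h d) /lp_seq
  big_ord_recl.
(* The constant component of f has no derivative; dropping it aligns the sum with the shifted index
   of [pd]. *)
rewrite [X in X + _](_ : _ = 0) ?add0r; last first.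
  rewrite /lp_poly big1 // => i _; rewrite big1 // => j _.
  by rewrite [(f _)^`M(i)]dhomog0_mderiv ?symhat_homog // mulr0 mul0r.
under [RHS]eq_bigr do rewrite symhatME.
rewrite exchange_big; apply: eq_bigr => s _; rewrite /lp_poly.
apply: eq_bigr => i _; rewrite rhoE mulr_sumr; apply: eq_bigr => j _.
by rewrite mulrCA mulrA.
Qed.

Lemma formal_poisson_isomorphic_intro (k : fieldType) (A B : comAlgType k)
    (FA : nat -> A -> Prop) (FB : nat -> B -> Prop)
    (bA : A -> A -> A) (bB : B -> B -> B) (phi : A -> B) (psi : B -> A) :
  linear phi -> phi 1 = 1 -> (forall f h, phi (f * h) = phi f * phi h) ->
  cancel phi psi -> cancel psi phi ->
  (forall N f, FA N f -> FB N (phi f)) -> (forall N f, FB N f -> FA N (psi f)) ->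
  (forall f h, phi (bA f h) = bB (phi f) (phi h)) ->
  formal_poisson_isomorphic FA FB bA bB.
Proof.
move=> phi_lin phi1 phiM phiK psiK phi_fil psi_fil phiP.
have psi_lin : linear psi.
  by move=> c u v; apply: (can_inj phiK); rewrite phi_lin !psiK.
have psi_mon : monoid_morphism psi.
  split=> [|u v]; apply: (can_inj phiK); rewrite ?phiM !psiK //.
have phi_mon : monoid_morphism phi by [].
pose Phi : {lrmorphism A -> B} := HB.pack phi
  (GRing.isLinear.Build k A B _ phi phi_lin) (GRing.isMonoidMorphism.Build A B
    phi phi_mon).
pose Psi : {lrmorphism B -> A} := HB.pack psi
  (GRing.isLinear.Build k B A _ psi psi_lin) (GRing.isMonoidMorphism.Build B A
    psi psi_mon).
by exists Phi, Psi; split=> // N; exists N => f; [apply: phi_fil | apply: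
  psi_fil].
Qed.

Section DualBasis.
Variables (k : fieldType) (g : vectType k) (b : g -> g -> g) (r : 'M[k]_(\dim
  {:g})).
Hypothesis qt : is_quasitriangular b r.
Local Notation n := (\dim {:g}).
Local Notation e i := (vbasis {:g})`_i.

Definition dual_elt (i : 'I_n) : dual g := linfun (coord (vbasis {:g}) i : g ->
  k^o).

Lemma dual_eltE i x : dual_elt i x = crd i x.
Proof. by rewrite lfunE. Qed.

Lemma dual_sum (xi : dual g) : xi = \sum_(i < n) (xi (e i) : k) *: dual_elt i.
Proof.
apply/lfunP => x; rewrite sum_lfunE {1}[x]crd_sum linear_sum; apply: eq_bigr =>
  i _.
by rewrite lfunE linearZ /= dual_eltE; apply: mulrC.
Qed.

(** [linfun] returns its argument only if that argument is linear, so the defining sum is first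
    packaged as a linear map; this is where linearity of the cobracket enters. *)
Lemma dual_bracketE (xi eta : dual g) (l : 'I_n) : dual_bracket b r xi eta (e l) =
  \sum_(i < n) \sum_(j < n) dual_const b r i j l * (xi (e i) * eta (e j)).
Proof.
have cob_lin c x y i j : cobracket b r (c *: x + y) i j =
    c * cobracket b r x i j + cobracket b r y i j.
  rewrite /cobracket !ad2E mulrDr addrACA !mulr_sumr -!big_split /=.
  by apply: eq_bigr => p _; rewrite !(lie_linearl (qt_lie qt)) !linearP /=; ring.
pose F (x : g) : k^o := \sum_(i < n) \sum_(j < n) cobracket b r x i j * (xi (e
  i) * eta (e j)).
have F_linear : linear F.
  move=> c x y; rewrite /F scaler_sumr -big_split; apply: eq_bigr => i _ /=.
  rewrite scaler_sumr -big_split; apply: eq_bigr => j _ /=.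
  by rewrite cob_lin mulrDl -mulrA.
pose FL : {linear g -> k^o} := HB.pack F (GRing.isLinear.Build k g k^o _ F
  F_linear).
exact: (lfunE FL).
Qed.

End DualBasis.

Theorem theorem0p1 (k : fieldType) (char0 : [pchar k] =i pred0)
    (g : vectType k) (b : g -> g -> g) (r : 'M[k]_(\dim {:g}))
    (qt : is_quasitriangular b r)
    (P : envdual (dual_bracket b r) -> envdual (dual_bracket b r) ->
         envdual (dual_bracket b r))
    (plP : is_poisson_lie_bracket P) :
  formal_poisson_isomorphic
    (@symhat_filt k (\dim {:g})) (@envdual_filt k (dual g) (dual_bracket b r))
    (lie_poisson b) P.
Proof.
have [U [U1 parC rho_parC]] := dressing_frame char0 qt.
have [W UW] := right_inverse_mx U1.
have C_anti := lie_const_anti qt; have D_anti := dual_const_anti qt.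
have [kap [kap1 kapM fil_kapB kapP]] :=
  linearization char0 UW U1 C_anti D_anti parC rho_parC.
have [kapi kapiK [kapK fil_kapi]] := kap_inverse fil_kapB.
pose x (i : 'I_(\dim {:g})) (xi : dual g) : k := xi (vbasis {:g})`_i.
pose eps i := @dual_elt k g i.
have x_linear i c u v : x i (c *: u + v) = c * x i u + x i v.
  by rewrite /x add_lfunE scale_lfunE.
have x_eps u : u = \sum_i x i u *: eps i := dual_sum u.
have x_delta i j : x i (eps j) = (i == j)%:R.
  by rewrite /x dual_eltE crd_basis eq_sym.
have x_bk u v l : x l (dual_bracket b r u v) =
    \sum_i \sum_j dual_const b r i j l * (x i u * x j v) := dual_bracketE qt u v
      l.
pose th := theta parC x_linear x_bk.
have [u [eu_u ev_u]] := theta_inverse_exists char0 W (dual_bracket b r) eps.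
have theta_invK : cancel u th := theta_invK char0 UW parC x_linear x_eps x_delta
  x_bk eu_u ev_u.
have thK : cancel th u := thetaK char0 UW parC x_linear x_delta x_bk eu_u ev_u.
have P_lin F G z : P F G [:: z] =
    \sum_m x m z *: \sum_i \sum_j lie_const b i j m *: (F [:: eps i] * G [:: eps
      j] : k^o).
  (* The differential of H at the origin has the values of H on the dual basis as coordinates, so
     the linearization property gives P on every one-letter word. *)
  have diff (H : envdual (dual_bracket b r)) : has_differential H (\sum_i (H [::
    eps i] : k) *: (vbasis {:g})`_i).
    move=> xi; rewrite (envdual_expand x_eps) linear_sum; apply: eq_bigr => i _.
    by rewrite linearZ; apply: mulrC.
  have crd_diff (H : envdual (dual_bracket b r)) i : crd i (\sum_j (H [:: eps j]
    : k) *: (vbasis {:g})`_j) = H [:: eps i].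
    rewrite linear_sum (bigD1 i) //= linearZ /= crd_basis eqxx mulr1.
    rewrite big1 ?addr0 // => j /negPf ji.
    by rewrite linearZ /= crd_basis eq_sym ji mulr0.
  rewrite (pl_linearization plP (diff F) (diff G)) (dual_b qt).
  apply: eq_bigr => m _; congr (_ * _); apply: eq_bigr => i _; apply: eq_bigr =>
    j _.
  by rewrite !crd_diff.
(* [kap] carries the linear bracket to the explicit one, and the Taylor map [th] carries the latter
   to P. *)
apply: (@formal_poisson_isomorphic_intro _ _ _ _ _ _ _ (th \o kap) (kapi \o u)).
- by move=> c f h /=; rewrite linearP; apply: theta_linear.
- by rewrite /= kap1; apply: theta1.
- by move=> f h /=; rewrite kapM; apply: thetaM.
- by move=> f /=; rewrite thK kapK.
- by move=> f /=; rewrite kapiK theta_invK.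
- move=> N f fN; apply: fil_theta; apply: fil_kap fil_kapB _ _ fN.
- by move=> N f fN; apply/fil_kapi/(theta_inv_fil char0 eu_u ev_u).
move=> f h; rewrite lie_poissonE /= kapP.
exact: (theta_pl_bracket parC x_linear x_delta x_bk rho_parC (pl_multiplicative
  plP) P_lin).
Qed.
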